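(* Let $\varepsilon,\delta\ge0$, let $M,N$ be positive integers, and let $\Lambda>0$. Let $P(z)$ be a nonzero polynomial of degree $M$ and $Q(z)$ a monic polynomial of degree $N$ with complex coefficients, and let $S$ be the multiset of the $N$ roots of $Q$. Assume (1) $S\subseteq B_{\Lambda/2}$, and (2) $\nu\varepsilon+2-(N-k)\delta\neq0$ for all integers $0\le k\le N$, $0\le\nu\le M$. For each $\nu\ge0$ define $k_\nu=-1$ if $\nu\varepsilon+2>N\delta$, and otherwise let $k_\nu$ be the integer with $0\le k_\nu\le N-1$ and $(N-k_\nu-1)\delta<\nu\varepsilon+2<(N-k_\nu)\delta$. For a root $\alpha$ of $Q$ define $$\Phi_{\nu,k}(\alpha)=\begin{cases}L_k(\alpha)^{(N-k)\delta-(\nu\varepsilon+2)}\prod_{0\le i<k}L_i(\alpha)^{\delta}, & k\ge0,\\ \Lambda^{N\delta-(\nu\varepsilon+2)}, & k<0.\end{cases}$$ Then $$\int_{B_\Lambda}\frac{|P(z)|^\varepsilon}{|Q(z)|^\delta}\,dV\ \sim\ \sum_{\{\alpha:Q(\alpha)=0\}}\ \sum_{\{\nu:P^{(\nu)}(\alpha)\ne0\}}\frac{|P^{(\nu)}(\alpha)|^\varepsilon}{\Phi_{\nu,k_\nu}(\alpha)},$$ where $\sim$ means each side is bounded by a positive constant multiple of the other (with the convention $1/0=\infty$, so one side is infinite iff the other is), with constants depending only on $\varepsilon,\delta,M,N$ and not on $P,Q,\Lambda$.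
   Context: $dV=dx\,dy$ is Lebesgue measure on $\mathbb{C}$, and $B_r$ is the open disk of radius $r$ centered at $0$. For a set $A\subseteq\mathbb{C}$, $d(A)=\sup_{\alpha,\beta\in A}|\alpha-\beta|$. Local cluster scales: for a root $\alpha\in S$ and $0\le k\le N-1$, $L_k(\alpha)=\inf d(S_{N-k}(\alpha))$, the infimum over all sub-multisets $S_{N-k}(\alpha)\subseteq S$ with $N-k$ elements containing $\alpha$. One has $L_0(\alpha)\ge L_1(\alpha)\ge\dots\ge L_{N-1}(\alpha)=0$. $P^{(\nu)}$ is the $\nu$-th derivative of $P$. *)

(* Defs.v *)
From HB Require Import structures.
From mathcomp Require Import all_boot all_order all_algebra.
From mathcomp Require Import all_classical all_reals all_analysis.
From mathcomp.real_closed Require Import complex.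
Set Implicit Arguments. Unset Strict Implicit. Unset Printing Implicit Defensive.
Import Order.TTheory GRing.Theory Num.Theory.
Import numFieldNormedType.Exports.

Local Open Scope ring_scope.

Section Defs.
Variable R : realType.

Definition cabs (z : R[i]) : R := Normc.normc z.

Definition cpt (p : R * R) : R[i] := (p.1 +i* p.2)%C.

Definition disk (r : R) : set (R * R) := fun p => cabs (cpt p) < r.

Definition dV := (@lebesgue_measure R \x @lebesgue_measure R)%E.

Variable N : nat.
Variable r : 'I_N -> R[i].  (* the roots of Q, listed with multiplicity *)

Definition diam (I : {set 'I_N}) : R :=
  \big[Num.max/0]_(a in I) \big[Num.max/0]_(b in I) cabs (r a - r b).

(* L_k(alpha): infimum (= minimum, finitely many choices) of the diameters of
   the sub-multisets of S with N - k elements containing alpha *)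
Definition Lk (alpha : R[i]) (k : nat) : R :=
  \big[Num.min/diam [set: 'I_N]%SET]_(I : {set 'I_N} |
       [exists j in I, r j == alpha] && (#|I| == N - k)%N) diam I.

(* k_nu, with k_nu = -1 encoded as None *)
Definition knu (eps delta : R) (nu : nat) : option 'I_N :=
  if N%:R * delta < nu%:R * eps + 2 then None
  else [pick k : 'I_N | ((N - k - 1)%:R * delta < nu%:R * eps + 2)
                        && (nu%:R * eps + 2 < (N - k)%:R * delta)].

Definition Phi (eps delta Lambda : R) (alpha : R[i]) (nu : nat) : R :=
  match knu eps delta nu with
  | None => Lambda `^ (N%:R * delta - (nu%:R * eps + 2))
  | Some k => Lk alpha k `^ ((N - k)%:R * delta - (nu%:R * eps + 2))
              * \prod_(i < k) Lk alpha i `^ delta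
  end.

Definition rhs_term (eps delta Lambda : R) (P : {poly R[i]}) (alpha : R[i])
    (nu : nat) : \bar R :=
  let ph := Phi eps delta Lambda alpha nu in
  if ph == 0 then +oo%E
  else ((cabs (P^`(nu)).[alpha]) `^ eps / ph)%:E.

(* right-hand side: sum over the distinct roots alpha of Q and over the nu
   with P^(nu)(alpha) <> 0 (necessarily nu <= M = deg P) *)
Definition rhs (eps delta Lambda : R) (M : nat) (P : {poly R[i]}) : \bar R :=
  (\sum_(alpha <- undup [seq r i | i <- enum 'I_N])
     \sum_(nu < M.+1 | ((P^`(nu)).[alpha] != 0)%R)
        rhs_term eps delta Lambda P alpha nu)%E.

End Defs.

(* integrand |P(z)|^eps / |Q(z)|^delta (value +oo where the denominator
   vanishes, a null set) *)
Definition integrand (R : realType) (eps delta : R) (P Q : {poly R[i]})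
    (p : R * R) : \bar R :=
  let q := cabs Q.[cpt p] `^ delta in
  if q == 0 then +oo%E else ((cabs P.[cpt p]) `^ eps / q)%:E.

Definition lhs (R : realType) (eps delta Lambda : R) (P Q : {poly R[i]})
    : \bar R :=
  (\int[@dV R]_(p in disk Lambda) integrand eps delta P Q p)%E.

(* Main.v *)
Require Import Defs.
From HB Require Import structures.
From mathcomp Require Import all_boot all_order all_algebra.
From mathcomp Require Import all_classical all_reals all_analysis.
From mathcomp Require Import measurable_realfun.
From mathcomp.real_closed Require Import complex.
From mathcomp Require Import zify ring lra.
Import Order.TTheory GRing.Theory Num.Theory.
Local Open Scope ring_scope.

(* The disk is split according to the root nearest to z.  If alpha is that root and
   u = |z - alpha|, then |z - beta| is comparable with max(u, |alpha - beta|) for every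
   root beta, and Taylor's formula at alpha bounds |P|; so the integrand is dominated by
   the sum over nu of |P^(nu)(alpha)|^eps u^(nu eps) D(u)^(-delta), where
   D(u) = prod_beta max(u, |alpha - beta|).  By the non-resonance assumption,
   u^(nu eps + 2) D(u)^(-delta) increases like a power of u below the critical scale
   L_(k_nu)(alpha) (or Lambda) and decreases like a power above it, and its peak value is
   comparable with 1 / Phi_(nu, k_nu)(alpha).  Summing over dyadic squares gives the upper
   bound.  For the lower bound, P is factored: among M + 1 well spaced points of the disk of
   radius rho about alpha one is far from all M zeros of P, and on a square around it |P|
   dominates |P^(nu)(alpha)| rho^nu.  The integral over this square is at least a multiple
   of |P^(nu)(alpha)|^eps rho^(nu eps + 2) D(rho)^(-delta); take for rho half the critical
   scale, or let rho tend to 0 when that scale is 0. *)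

(** * The modulus of complex numbers *)

Section ComplexModulus.
Context {R : realType}.
Implicit Types z w : R[i].

Lemma cabs_ge0 z : 0 <= cabs z.
Proof. by case: z => a b; exact: sqrtr_ge0. Qed.

Lemma cabs0 : cabs (0 : R[i]) = 0. Proof. exact: Normc.normc0. Qed.

Lemma cabs1 : cabs (1 : R[i]) = 1. Proof. exact: Normc.normc1. Qed.

Lemma cabsM z w : cabs (z * w) = cabs z * cabs w.
Proof. exact: Normc.normcM. Qed.

Lemma cabsX z n : cabs (z ^+ n) = cabs z ^+ n.
Proof. by elim: n => [|n IHn]; rewrite ?expr0 ?cabs1 // !exprS cabsM IHn. Qed.

Lemma cabsN z : cabs (- z) = cabs z. Proof. exact: normcN. Qed.

Lemma cabsC z w : cabs (z - w) = cabs (w - z).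
Proof. by rewrite -cabsN opprB. Qed.

Lemma cabs_triangle z w : cabs (z + w) <= cabs z + cabs w.
Proof. exact: le_normcD. Qed.

Lemma cabs_dist_triangle x z w : cabs (z - w) <= cabs (z - x) + cabs (x - w).
Proof. by have := cabs_triangle (z - x) (x - w); rewrite addrA subrK. Qed.

Lemma cabs_eq0 z : (cabs z == 0) = (z == 0).
Proof. by apply/eqP/eqP => [/Normc.eq0_normc|->] //; exact: cabs0. Qed.

Lemma cabs_prod (I : Type) (s : seq I) (F : I -> R[i]) :
  cabs (\prod_(i <- s) F i) = \prod_(i <- s) cabs (F i).
Proof. by elim: s => [|i s IHs]; rewrite ?big_nil ?cabs1 // !big_cons cabsM IHs. Qed.

Lemma cabs_sum_le (I : Type) (s : seq I) (p : pred I) (F : I -> R[i]) :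
  cabs (\sum_(i <- s | p i) F i) <= \sum_(i <- s | p i) cabs (F i).
Proof.
elim/big_rec2: _ => [|i x z _ xz]; first by rewrite cabs0.
by apply: le_trans (cabs_triangle _ _) _; rewrite lerD2l.
Qed.

Lemma cabs_nat n : cabs (n%:R : R[i]) = n%:R.
Proof.
elim: n => [|n IHn]; first exact: cabs0.
by rewrite /cabs normcMn ?Normc.normc1.
Qed.

Lemma cabs_real (x : R) : cabs (x +i* 0)%C = `|x|.
Proof. by rewrite /cabs /= expr0n /= addr0 sqrtr_sqr. Qed.

Lemma norm_Re_le z : `|complex.Re z| <= cabs z.
Proof.
case: z => a b; rewrite /cabs /= -sqrtr_sqr ler_wsqrtr // lerDl; exact: sqr_ge0.
Qed.

Lemma norm_Im_le z : `|complex.Im z| <= cabs z.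
Proof.
case: z => a b; rewrite /cabs /= -sqrtr_sqr ler_wsqrtr // lerDr; exact: sqr_ge0.
Qed.

Lemma cabs_le_ReIm z : cabs z <= `|complex.Re z| + `|complex.Im z|.
Proof.
case: z => a b; rewrite /cabs /=.
rewrite -[leRHS]ger0_norm ?addr_ge0 // -sqrtr_sqr ler_wsqrtr //.
rewrite sqrrD !real_normK ?num_real // -addrA lerD2l lerDr.
by rewrite mulrn_wge0 // mulr_ge0.
Qed.

End ComplexModulus.

(** * Diameters of clusters of roots and the scales [Lk] *)

Lemma exists_subset_card (T : finType) (J : {set T}) (m : nat) :
  (m <= #|J|)%N -> exists2 I : {set T}, I \subset J & #|I| = m.
Proof.
move=> mJ; exists [set x in take m (enum J)].
  by apply/fintype.subsetP => x; rewrite inE => /mem_take; rewrite mem_enum.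
rewrite cardsE (card_uniqP _) ?size_takel -?cardE //.
by rewrite take_uniq // enum_uniq.
Qed.

Section ClusterScales.
Context {R : realType} {N : nat} (r : 'I_N -> R[i]).
Implicit Types (I : {set 'I_N}) (k : nat).

Lemma le_diam I a b : a \in I -> b \in I -> cabs (r a - r b) <= diam r I.
Proof.
move=> aI bI; apply: le_trans (le_bigmax_cond _ _ aI).
exact: (le_bigmax_cond _ (fun b => cabs (r a - r b))).
Qed.

Lemma diam_ge0 I : 0 <= diam r I.
Proof. exact: bigmax_ge_id. Qed.

Lemma diam_lt I x : 0 < x ->
  (forall a b, a \in I -> b \in I -> cabs (r a - r b) < x) -> diam r I < x.
Proof.
by move=> x0 Ix; apply: bigmax_lt => // a aI; apply: bigmax_lt => // b; exact: Ix.
Qed.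

Lemma diamS (I J : {set 'I_N}) : I \subset J -> diam r I <= diam r J.
Proof.
move=> /fintype.subsetP IJ; apply: bigmax_le => [|a /IJ aJ]; first exact: diam_ge0.
by apply: bigmax_le => [|b /IJ bJ]; [exact: diam_ge0 | exact: le_diam].
Qed.

Variable j0 : 'I_N.
Notation alpha := (r j0).
Notation L := (Lk r alpha).
Notation d j := (cabs (alpha - r j)).

Lemma Lk_attained k : (k < N)%N -> exists I : {set 'I_N},
  [/\ exists2 j, j \in I & r j = alpha, #|I| = (N - k)%N & L k = diam r I].
Proof.
move=> kN.
(* The index [j0] with [N - k - 1] others is an admissible set, and no diameter exceeds the default
   value of the minimum, so the minimum is attained. *)
have [|I jI cI] := @exists_subset_card _ [set~ j0] (N - k).-1.
  by rewrite cardsC1 card_ord; lia.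
have j0I : j0 \notin I.
  by apply/negP => /(fintype.subsetP jI); rewrite !inE eqxx.
have [|J _|J /andP[/existsP[j /andP[jJ /eqP jr]] /eqP cJ] LJ] :=
  @eq_bigmin _ _ _ (diam r [set: 'I_N]%SET) (j0 |: I)%SET
    (fun I => [exists j in I, r j == alpha] && (#|I| == N - k)%N) (diam r).
- apply/andP; split; first by apply/existsP; exists j0; rewrite !inE eqxx /=.
  by rewrite cardsU1 j0I cI; apply/eqP; lia.
- by apply: diamS; apply/fintype.subsetP => x; rewrite inE.
- by exists J; split => //; exists j.
Qed.

Lemma Lk_le_diam k I j : j \in I -> r j = alpha -> #|I| = (N - k)%N ->
  L k <= diam r I.
Proof.
move=> jI rj cI; apply: (bigmin_le_cond _ (diam r)).
by apply/andP; split; [apply/existsP; exists j; rewrite jI rj eqxx | rewrite cI].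
Qed.

Lemma Lk_ge0 k : 0 <= L k.
Proof. by apply: le_bigmin => *; exact: diam_ge0. Qed.

Lemma Lk_le_diamT k : L k <= diam r [set: 'I_N]%SET.
Proof. exact: bigmin_le_id. Qed.

(** From a minimising set for [k], drop one index other than a chosen copy of [alpha]: the rest is
    admissible for [k.+1] and has no larger diameter. *)
Lemma Lk_succ_le k : (k.+1 < N)%N -> L k.+1 <= L k.
Proof.
move=> kN; have [|I [[j jI rj] cI ->]] := @Lk_attained k; first by lia.
have [|J JI cJ] := @exists_subset_card _ (I :\ j)%SET (N - k).-2.
  by move: cI; rewrite (cardsD1 j I) jI; lia.
have jJ : j \notin J by apply/negP => /(fintype.subsetP JI); rewrite !inE eqxx.
apply: le_trans (diamS (j |: J)%SET I _).
  apply: (@Lk_le_diam _ _ j) => //; first by rewrite !inE eqxx.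
  by rewrite cardsU1 jJ cJ; lia.
apply/fintype.subsetP => x; rewrite !inE => /orP[/eqP -> //|].
by move=> /(fintype.subsetP JI); rewrite !inE => /andP[].
Qed.

(** All members of a minimising set lie within its diameter of [alpha]. *)
Lemma card_dist_le_Lk k : (k < N)%N -> (N - k <= #|[set j | (d j <= L k)%R]|)%N.
Proof.
move=> kN; have [I [[i iI ri] <- ->]] := Lk_attained _ kN.
by apply: subset_leq_card; apply/fintype.subsetP => j jI; rewrite inE -ri le_diam.
Qed.

(** Otherwise [N - k] indices, [j0] among them, would lie within [L k / 2] of [alpha]. Any two are
    then less than [L k] apart through [alpha], against minimality. *)
Lemma card_dist_lt_Lk k : (k < N)%N ->
  (#|[set j | (d j < L k / 2)%R]| <= N - k - 1)%N.
Proof.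
move=> kN; set J := [set j | _]; rewrite leqNgt; apply/negP => cJ.
have [j] : exists j, j \in J by apply/finset.set0Pn; rewrite -card_gt0; lia.
rewrite inE => dj; have L0 : 0 < L k.
  by have := cabs_ge0 (alpha - r j); lra.
have j0J : j0 \in J by rewrite inE subrr cabs0; lra.
have [|I IJ cI] := @exists_subset_card _ (J :\ j0)%SET (N - k).-1.
  by move: cJ; rewrite (cardsD1 j0 J) j0J; lia.
have j0I : j0 \notin I by apply/negP => /(fintype.subsetP IJ); rewrite !inE eqxx.
have : L k <= diam r (j0 |: I)%SET.
  apply: (@Lk_le_diam _ _ j0) => //; first by rewrite !inE eqxx.
  by rewrite cardsU1 j0I cI; lia.
apply/negP; rewrite -ltNge; apply: diam_lt => // a b aI bI.
have dL c : c \in (j0 |: I)%SET -> d c < L k / 2.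
  rewrite !inE => /orP[/eqP ->|/(fintype.subsetP IJ)]; last by rewrite !inE => /andP[].
  by rewrite subrr cabs0; lra.
apply: le_lt_trans (cabs_dist_triangle alpha _ _) _.
by rewrite cabsC; have := dL _ aI; have := dL _ bI; lra.
Qed.

End ClusterScales.

(** * The product of truncated distances and its growth in the radius *)

Section TruncatedProduct.
Context {R : realType} {N : nat} (r : 'I_N -> R[i]) (alpha : R[i]).
Notation d j := (cabs (alpha - r j)).

(** The function D of the overview: up to a factor 2^N, the modulus of Q at a point at distance [t]
    from [alpha] that has [alpha] as nearest root. *)
Definition maxprod (t : R) : R := \prod_(j < N) Num.max t (d j).

Lemma maxprod_gt0 t : 0 < t -> 0 < maxprod t.
Proof. by move=> t0; apply: prodr_gt0 => j _; rewrite lt_max t0. Qed.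

Lemma maxprod_le (s t : R) : 0 <= s -> s <= t -> maxprod s <= maxprod t.
Proof.
move=> s0 st; apply: ler_prod => j _.
by rewrite le_max s0 /= ge_max !le_max st lexx orbT.
Qed.

Let prod_if (A : {set 'I_N}) (x : R) :
  \prod_(j < N) (if j \in A then x else 1) = x ^+ #|A|.
Proof. by rewrite -big_mkcond prodr_const. Qed.

(** Each factor with [d j <= s] is multiplied by exactly [t / s] when the radius passes from [s] to
    [t]; the other factors do not decrease. *)
Lemma maxprod_growth (s t : R) m : 0 < s -> s <= t ->
  (m <= #|[set j | (d j <= s)%R]|)%N -> (t / s) ^+ m * maxprod s <= maxprod t.
Proof.
move=> s0 st mA; set A := [set j | _] in mA.
have ts1 : 1 <= t / s by rewrite ler_pdivlMr // mul1r.
apply: (@le_trans _ _ ((t / s) ^+ #|A| * maxprod s)).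
  by apply: ler_wpM2r; [rewrite ltW ?maxprod_gt0 | exact: ler_weXn2l].
rewrite -prod_if -big_split /=; apply: ler_prod => j _.
have dj := cabs_ge0 (alpha - r j).
rewrite inE; case: ifPn => [js|_]; last first.
  by rewrite mul1r le_max dj orbT /= ge_max !le_max lexx st orbT.
by rewrite (max_l js) divfK ?gt_eqF // le_max lexx andbT; apply: le_trans st; exact: ltW.
Qed.

(** A converse to the growth bound: a factor with [d j >= t / 2] at most doubles, since
    [Num.max t (d j) <= 2 * d j]. Only the remaining ones can gain as much as [t / s]. *)
Lemma maxprod_doubling (s t : R) m : 0 < s -> s <= t ->
  (#|[set j | (d j < t / 2)%R]| <= m)%N ->
  maxprod t <= 2 ^+ N * (t / s) ^+ m * maxprod s.
Proof.
move=> s0 st Bm; set B := [set j | _] in Bm.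
have ts1 : 1 <= t / s by rewrite ler_pdivlMr // mul1r.
apply: (@le_trans _ _ (2 ^+ N * (t / s) ^+ #|B| * maxprod s)); last first.
  apply: ler_wpM2r; first by rewrite ltW ?maxprod_gt0.
  by apply: ler_wpM2l; [exact: exprn_ge0 | exact: ler_weXn2l].
rewrite -prod_if -[X in 2 ^+ X]card_ord -prodr_const -!big_split /=.
apply: ler_prod => j _; have dj := cabs_ge0 (alpha - r j).
apply/andP; split; first by rewrite le_max dj orbT.
rewrite inE; case: ifPn => [jt|]; last first.
  rewrite -leNgt mulr1 => jt.
  have : d j <= Num.max s (d j) by rewrite le_max lexx orbT.
  by rewrite ge_max; lra.
rewrite max_l; last by lra.
apply: (@le_trans _ _ (2 * (t / s) * s)); first by rewrite -mulrA divfK ?gt_eqF //; lra.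
by rewrite ler_pM2l ?le_max ?lexx // mulr_gt0 //; lra.
Qed.

End TruncatedProduct.

(** * Comparison of the truncated product with the product of the scales *)

Section ScaleProduct.
Context {R : realType} {N : nat} (r : 'I_N -> R[i]) (j0 : 'I_N).
Notation alpha := (r j0).
Notation L := (Lk r alpha).

(** The part of [Phi] carrying the exponent [delta]: for [k] critical, [Phi] is [L k] to the power
    -(nu eps + 2) times [scaleprod k] to the power [delta]. *)
Definition scaleprod (k : nat) : R := L k ^+ (N - k) * \prod_(i < k) L i.

(** The ratio of consecutive values has the shape of the factors in [maxprod_growth] and
    [maxprod_doubling] between [L k.+1] and [L k], so both comparisons below go by induction on
    [k]. *)
Lemma scaleprod_succ k : (k < N)%N -> 0 < L k ->
  scaleprod k.+1 = (L k.+1 / L k) ^+ (N - k.+1) * scaleprod k.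
Proof.
move=> kN L0; rewrite /scaleprod big_ord_recr /= subnS.
have -> : (N - k)%N = (N - k).-1.+1 by lia.
rewrite /= expr_div_n exprS; set p := L k.+1 ^+ _; set q := L k ^+ _.
have q0 : q != 0 by rewrite expf_neq0 // gt_eqF.
by rewrite [L k * q]mulrC !mulrA divfK // -!mulrA [L k * _]mulrC.
Qed.

(** At [k = 0] all N roots lie within [L 0] of [alpha], so every factor is [L 0]. In the step, at
    least [N - k.+1] roots lie within [L k.+1], so [maxprod] shrinks at least as much as
    [scaleprod]. *)
Lemma maxprod_le_scaleprod k : (k < N)%N -> 0 < L k ->
  maxprod r alpha (L k) <= scaleprod k.
Proof.
elim: k => [|k IHk] kN L0.
  rewrite /scaleprod big_ord0 mulr1 subn0 /maxprod -[X in _ ^+ X]card_ord -prodr_const.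
  apply: ler_prod => j _; rewrite le_max ltW //= ge_max lexx /=.
  have : j \in [set j | (cabs (alpha - r j) <= L 0%N)%R].
    suff -> : [set j | (cabs (alpha - r j) <= L 0%N)%R] = [set: 'I_N]%SET by rewrite inE.
    apply/eqP; rewrite eqEcard; apply/andP; split; first exact: finset.subsetT.
    by rewrite cardsT card_ord; have := card_dist_le_Lk r j0 _ kN; rewrite subn0.
  by rewrite inE.
have Lk_ge : L k.+1 <= L k by exact: Lk_succ_le.
have Lk0 : 0 < L k by exact: lt_le_trans Lk_ge.
rewrite scaleprod_succ //; last by lia.
have := maxprod_growth r alpha _ _ _ L0 Lk_ge (card_dist_le_Lk r j0 _ kN).
have /IHk/(_ Lk0) IH : (k < N)%N by lia.
move=> H; have := le_trans H IH.
by rewrite -[L k / _]invf_div exprVn mulrC ler_pdivrMr ?exprn_gt0 ?divr_gt0 // mulrC.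
Qed.

(** Fewer than [N - k] roots lie within [L k / 2], so [maxprod_doubling] bounds the loss from [L k]
    to [L k.+1]; each of the [k] steps costs a factor 2^N. *)
Lemma scaleprod_le_maxprod k : (k < N)%N -> 0 < L k ->
  scaleprod k <= 2 ^+ (N * k) * maxprod r alpha (L k).
Proof.
elim: k => [|k IHk] kN L0.
  rewrite /scaleprod big_ord0 mulr1 subn0 muln0 expr0 mul1r /maxprod.
  rewrite -[X in _ ^+ X]card_ord -prodr_const.
  by apply: ler_prod => j _; rewrite ltW //= le_max lexx.
have Lk_ge : L k.+1 <= L k by exact: Lk_succ_le.
have Lk0 : 0 < L k by exact: lt_le_trans Lk_ge.
have kN' : (k < N)%N by lia.
rewrite scaleprod_succ //.
have := maxprod_doubling r alpha _ _ _ L0 Lk_ge (card_dist_lt_Lk r j0 _ kN').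
rewrite -subnDA addn1 => H.
rewrite mulnS exprD mulrC -ler_pdivlMr ?exprn_gt0 ?divr_gt0 //.
apply: le_trans (IHk kN' Lk0) _.
rewrite -exprVn invf_div [leRHS](_ : _ = 2 ^+ (N * k) *
  (2 ^+ N * (L k / L k.+1) ^+ (N - k.+1) * maxprod r alpha (L k.+1))).
  by rewrite ler_pM2l // exprn_gt0.
by rewrite !mulrA [2 ^+ N * 2 ^+ _]mulrC mulrAC.
Qed.

End ScaleProduct.

(** * Upper and lower bounds for a polynomial by its derivatives at a point *)

Section PolynomialBounds.
Context {R : realType}.
Implicit Types (P : {poly R[i]}) (alpha z : R[i]).

Lemma cabs_nderivn_le P alpha n : cabs (P^`N(n)).[alpha] <= cabs (P^`(n)).[alpha].
Proof.
rewrite nderivn_def hornerMn -mulr_natl cabsM cabs_nat.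
by rewrite ler_peMl ?cabs_ge0 // ler1n fact_gt0.
Qed.

Lemma cabs_horner_le P alpha z :
  cabs P.[z] <= \sum_(n < size P) cabs (P^`(n)).[alpha] * cabs (z - alpha) ^+ n.
Proof.
rewrite -[in X in cabs X](subrK alpha z) addrC nderiv_taylor; last by rewrite /GRing.comm mulrC.
apply: le_trans (cabs_sum_le _ _ _ _) _; apply: ler_sum => n _.
by rewrite cabsM cabsX ler_wpM2r ?exprn_ge0 ?cabs_ge0 // cabs_nderivn_le.
Qed.

(** The derivative of top order is n! times the leading coefficient. Hence at every root the inner
    sum of the right-hand side is not empty. *)
Lemma derivn_lead_neq0 P alpha n : size P = n.+1 -> (P^`(n)).[alpha] != 0.
Proof.
move=> sP; have -> : P^`(n) = (lead_coef P *+ n`!)%:P.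
  apply/polyP => i; rewrite coef_derivn coefC lead_coefE sP /=.
  case: i => [|i]; first by rewrite addn0 ffactnn.
  by rewrite nth_default ?mul0rn // sP; lia.
rewrite hornerC -mulr_natl mulf_neq0 //.
by rewrite lead_coef_eq0 -size_poly_eq0 sP.
Qed.

(** The Taylor coefficients at [alpha] are [c] times elementary symmetric functions of the
    [alpha - z], so they are bounded by those of the product with each [alpha - z] replaced by its
    modulus. Evaluating at [rho] isolates one term of a sum of nonnegative ones. *)
Lemma cabs_nderivn_prod_le (c : R[i]) (s : seq R[i]) alpha (rho : R) n : 0 <= rho ->
  cabs ((c *: \prod_(z <- s) ('X - z%:P))^`N(n)).[alpha] * rho ^+ n
    <= cabs c * \prod_(z <- s) (rho + cabs (alpha - z)).
Proof.
move=> rho0; elim: s n => [|z s IHs] n.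
  rewrite !big_nil mulr1 alg_polyC; case: n => [|n].
    by rewrite nderivn0 hornerC !mulr1.
  by rewrite nderivnC hornerC cabs0 mul0r cabs_ge0.
rewrite !big_cons; set q := c *: _ in IHs.
(* In this form the product rule for divided derivatives with one linear factor applies. *)
have -> : c *: (('X - z%:P) * \prod_(j <- s) ('X - j%:P)) = q * 'X - z *: q.
  by rewrite scalerAr -/q mulrBl mul_polyC mulrC.
clearbody q.
set B := \prod_(j <- s) _ in IHs *.
have -> : cabs c * ((rho + cabs (alpha - z)) * B) =
  cabs c * B * rho + cabs c * B * cabs (alpha - z) by ring.
have IH m := IHs m; case: n => [|n].
  rewrite nderivn0 expr0 mulr1 (_ : _.[alpha] = (alpha - z) * q.[alpha]) ?cabsM; last first.
    by rewrite !hornerE; ring.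
  apply: le_trans (_ : cabs c * B * cabs (alpha - z) <= _); last first.
    by rewrite lerDr mulr_ge0 // (le_trans _ (IH 0%N)) // mulr_ge0 ?cabs_ge0 ?exprn_ge0.
  rewrite mulrC ler_wpM2r ?cabs_ge0 //.
  by have := IH 0%N; rewrite nderivn0 expr0 mulr1.
rewrite nderivnB nderivnZ -[q * 'X]addr0 -(polyC0) nderivnMXaddC !hornerE.
have -> : (q^`N(n)).[alpha] + (q^`N(n.+1)).[alpha] * alpha - z * (q^`N(n.+1)).[alpha]
  = (q^`N(n)).[alpha] + (q^`N(n.+1)).[alpha] * (alpha - z) by ring.
apply: le_trans (_ : (cabs (q^`N(n)).[alpha] +
   cabs (q^`N(n.+1)).[alpha] * cabs (alpha - z)) * rho ^+ n.+1 <= _).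
  by rewrite ler_wpM2r ?exprn_ge0 // -cabsM cabs_triangle.
rewrite mulrDl; apply: lerD.
  by rewrite exprSr mulrA ler_wpM2r.
by rewrite mulrAC ler_wpM2r ?cabs_ge0.
Qed.

(** Pigeonhole: [size s + 1] points are placed on a line, [4 * h] apart, starting at [alpha]. An
    entry of [s] is at distance less than [2 * h] from at most one of them. *)
Lemma exists_point_far_from_seq (s : seq R[i]) alpha (h : R) : 0 < h ->
  exists2 w, cabs (w - alpha) <= 4 * h * (size s)%:R &
             forall z, z \in s -> 2 * h <= cabs (w - z).
Proof.
move=> h0; pose w (i : 'I_(size s).+1) : R[i] := alpha + ((4 * h * i%:R) +i* 0)%C.
have [[i wi]|nw] := pselect (exists i, forall z, z \in s -> 2 * h <= cabs (w i - z)).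
  exists (w i) => //; rewrite /w addrC addKr cabs_real ger0_norm; last first.
    by rewrite !mulr_ge0 // ltW.
  by rewrite ler_pM2l ?mulr_gt0 // ler_nat -ltnS.
exfalso.
have near i : exists j : 'I_(size s), cabs (w i - s`_j) < 2 * h.
  apply: contrapT => nj; apply: nw; exists i => z zs.
  rewrite leNgt; apply/negP => lt; apply: nj.
  have js : (index z s < size s)%N by rewrite index_mem.
  by exists (Ordinal js); rewrite /= nth_index.
have [f fP] := choice near.
have finj : injective f.
  move=> i i' ff'; apply/val_inj/eqP; rewrite eqn_leq.
  have key (a b : 'I_(size s).+1) : f a = f b -> (a <= b)%N.
    move=> ab; rewrite leqNgt; apply/negP => ba.
    have := cabs_dist_triangle s`_(f a) (w a) (w b).
    rewrite [cabs (s`_ _ - _)]cabsC {2}ab.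
    have -> : w a - w b = ((4 * h * (a%:R - b%:R)) +i* 0)%C.
      rewrite /w opprD addrACA subrr add0r; apply/eqP; rewrite eq_complex /=.
      by apply/andP; split; apply/eqP; ring.
    have ab1 : 1 <= a%:R - b%:R :> R by rewrite lerBrDr addrC natr1 ler_nat.
    rewrite cabs_real ger0_norm; last by rewrite !mulr_ge0 //; lra.
    have := fP a; have := fP b; nra.
  by rewrite !key.
by have := leq_card f finj; rewrite !card_ord ltnn.
Qed.

(** Since [4 * h * M + 4 * h = rho], the disk of radius [h] about a point far from the zeros stays
    within [rho] of [alpha]. There |x - z| is compared with rho + |alpha - z| zero by zero; M!
    passes from divided to ordinary derivatives. *)
Lemma exists_square_poly_large (M : nat) P alpha (rho : R) (h := rho / (4 * M.+1%:R)) :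
  size P = M.+1 -> 0 < rho ->
  exists w, forall x, cabs (x - w) < h -> cabs (x - alpha) < rho /\
    forall n, (n <= M)%N ->
      cabs (P^`(n)).[alpha] * rho ^+ n <= M`!%:R * (8 * M%:R + 9) ^+ M * cabs P.[x].
Proof.
move=> sP rho0; have [s Ps] := closed_field_poly_normal P.
have P0 : lead_coef P != 0 by rewrite lead_coef_eq0 -size_poly_eq0 sP.
have ss : size s = M.
  by move: sP; rewrite Ps size_scale // size_prod_XsubC => -[].
have h0 : 0 < h by rewrite divr_gt0 // mulr_gt0.
have hrho : 4 * h * M%:R + 4 * h = rho.
  have M0 : M.+1%:R != 0 :> R by rewrite pnatr_eq0.
  by move: M0; rewrite /h -natr1 => M0; field.
have [w wa ws] := exists_point_far_from_seq s alpha h h0.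
exists w => x xw; have xa : cabs (x - alpha) < rho.
  apply: le_lt_trans (cabs_dist_triangle w _ _) _; rewrite ss in wa; lra.
split=> // n nM.
have -> : cabs P.[x] = cabs (lead_coef P) * \prod_(z <- s) cabs (x - z).
  rewrite [in LHS]Ps hornerZ cabsM horner_prod cabs_prod; congr (_ * _).
  by apply: eq_bigr => z _; rewrite hornerXsubC.
(* Here |x - z| >= h, so rho <= 4 (M + 1) |x - z|, and |alpha - z| <= rho + |x - z|. The sum is at
   most (8 (M + 1) + 1) |x - z|. *)
have dist z : z \in s -> rho + cabs (alpha - z) <= (8 * M%:R + 9) * cabs (x - z).
  move=> /ws wz.
  have xz : h <= cabs (x - z).
    by have := cabs_dist_triangle x w z; rewrite [cabs (w - x)]cabsC; lra.
  have := cabs_dist_triangle x alpha z; rewrite [cabs (alpha - x)]cabsC.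
  have M0 : 0 <= M%:R :> R by [].
  nra.
have prod_le : \prod_(z <- s) (rho + cabs (alpha - z)) <=
    (8 * M%:R + 9) ^+ M * \prod_(z <- s) cabs (x - z).
  have -> : (8 * M%:R + 9) ^+ M = \prod_(z <- s) (8 * M%:R + 9) :> R.
    by rewrite big_const_seq count_predT ss iter_mulr_1.
  rewrite -big_split /=.
  rewrite [leLHS]big_seq [leRHS]big_seq; apply: ler_prod => z zs.
  by rewrite dist // addr_ge0 ?cabs_ge0 // ltW.
rewrite nderivn_def hornerMn -mulr_natl cabsM cabs_nat -!mulrA.
apply: ler_pM; rewrite ?mulr_ge0 ?cabs_ge0 ?exprn_ge0 ?(ltW rho0) //.
  by rewrite ler_nat leq_fact.
rewrite [in leLHS]Ps; apply: le_trans (cabs_nderivn_prod_le _ _ _ _ _ (ltW rho0)) _.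
by rewrite mulrCA ler_wpM2l ?cabs_ge0.
Qed.

End PolynomialBounds.

(** The sum is at most [n] times its largest term, which serves for [eps] below and above 1 alike.
    Nonemptiness matters at [eps = 0], where 0 to the power 0 is 1. *)
Lemma powR_sum_le {R : realType} (n : nat) (p : pred 'I_n) (x : 'I_n -> R) (eps : R) :
  0 <= eps -> (exists i, p i) -> (forall i, 0 <= x i) ->
  (\sum_(i < n | p i) x i) `^ eps <= n%:R `^ eps * \sum_(i < n | p i) x i `^ eps.
Proof.
move=> eps0 [i0 pi0] x0; case: (arg_maxP x pi0) => j pj jmax.
have sum_le : \sum_(i < n | p i) x i <= n%:R * x j.
  apply: le_trans (_ : \sum_(i < n | p i) x j <= _).
    by apply: ler_sum => i pi; exact: jmax.
  rewrite sumr_const -[leLHS]mulr_natl ler_wpM2r // ler_nat.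
  by rewrite -[leqRHS]card_ord max_card.
apply: le_trans (_ : (n%:R * x j) `^ eps <= _).
  by apply: ge0_ler_powR; rewrite ?nnegrE ?sumr_ge0 ?mulr_ge0.
rewrite powRM // ler_wpM2l ?powR_ge0 // (bigD1 j) //= lerDl.
by apply: sumr_ge0 => i _; exact: powR_ge0.
Qed.

(** * Measurability of the integrand, and squares in the plane *)

Section PlaneMeasure.
Local Open Scope classical_set_scope.
Context {R : realType}.
Implicit Types (P Q : {poly R[i]}) (w : R[i]) (h : R).

(** Both parts are treated in one induction because multiplication by z mixes them in each Horner
    step. *)
Lemma measurable_horner P :
  measurable_fun [set: R * R] (fun p => complex.Re P.[cpt p]) /\
  measurable_fun [set: R * R] (fun p => complex.Im P.[cpt p]).
Proof.
elim/poly_ind: P => [|P c [mRe mIm]].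
  by split; under eq_fun do rewrite horner0; exact: measurable_cst.
split.
- rewrite (_ : (fun p => _) = (fun p => complex.Re P.[cpt p] * p.1
      - complex.Im P.[cpt p] * p.2 + complex.Re c)).
    by apply: measurable_funD => //; apply: measurable_funB; apply: measurable_funM.
  apply/funext => p; rewrite hornerMXaddC.
  by case: P.[cpt p] => a b; case: c => c1 c2; case: p.
- rewrite (_ : (fun p => _) = (fun p => complex.Re P.[cpt p] * p.2
      + complex.Im P.[cpt p] * p.1 + complex.Im c)).
    by apply: measurable_funD => //; apply: measurable_funD; apply: measurable_funM.
  apply/funext => p; rewrite hornerMXaddC.
  by case: P.[cpt p] => a b; case: c => c1 c2; case: p.
Qed.

Lemma measurable_cabs_horner P :
  measurable_fun [set: R * R] (fun p => cabs P.[cpt p]).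
Proof.
have [mRe mIm] := measurable_horner P.
rewrite (_ : (fun p => _) = (fun p => Num.sqrt (complex.Re P.[cpt p] ^+ 2 +
  complex.Im P.[cpt p] ^+ 2))); last first.
  by apply/funext => p; case: P.[cpt p].
apply: (measurableT_comp (f := @Num.sqrt R)).
  by apply: continuous_measurable_fun; exact: sqrt_continuous.
by apply: measurable_funD; apply: measurable_funX.
Qed.

Lemma measurable_integrand (eps delta : R) P Q :
  measurable_fun [set: R * R] (integrand eps delta P Q).
Proof.
have mpow s S : measurable_fun [set: R * R] (fun p => cabs S.[cpt p] `^ s).
  by apply: (measurableT_comp (measurable_powR s)); exact: measurable_cabs_horner.
apply: measurable_fun_ifT.
- by apply: measurable_fun_eqr => //; exact: mpow.
- exact: measurable_cst.
- apply/measurable_EFinP; apply: measurable_funM; first exact: mpow.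
  by under eq_fun do rewrite -powRN; exact: mpow.
Qed.

Lemma integrand_ge0 (eps delta : R) P Q p : (0 <= integrand eps delta P Q p)%E.
Proof.
by rewrite /integrand; case: ifP => _; rewrite ?leey // lee_fin divr_ge0 ?powR_ge0.
Qed.

Lemma measurable_disk h : measurable (@disk R h).
Proof.
have := measurable_cabs_horner ('X : {poly R[i]}).
move=> /(_ measurableT `]-oo, h[ (measurable_itv _)); rewrite setTI.
congr measurable; apply/seteqP; split => p /=; by rewrite in_itv /= hornerX.
Qed.

(** Half the side is [h]. Squares stand in for disks because their area is a product of lengths; the
    disk of radius [h] lies between the squares of parameters [h / 2] and [h]. *)
Definition square w h : set (R * R) :=
  `]complex.Re w - h, complex.Re w + h[ `*` `]complex.Im w - h, complex.Im w + h[.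

Lemma measurable_square w h : measurable (square w h).
Proof. by apply: measurableX; exact: measurable_itv. Qed.

Lemma dV_square w h : 0 < h -> @dV R (square w h) = (4 * h ^+ 2)%:E.
Proof.
move=> h0; rewrite /dV product_measure1E //; do 2?exact: measurable_itv.
have len (a : R) : lebesgue_measure (`]a - h, a + h[ : set R) = (2 * h)%:E.
  rewrite lebesgue_measure_itv /= lte_fin ifT; last by lra.
  by rewrite -EFinD; congr EFin; lra.
rewrite [LHS](_ : _ = (2 * h)%:E * (2 * h)%:E)%E; last first.
  by congr (_ * _)%E; exact: len.
by rewrite -EFinM; congr EFin; lra.
Qed.

Lemma squareP w h p :
  square w h p <-> `|p.1 - complex.Re w| < h /\ `|p.2 - complex.Im w| < h.
Proof. by rewrite /square /= !in_itv /= !ltr_distl. Qed.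

Lemma square_cabs_lt w h p : square w (h / 2) p -> cabs (cpt p - w) < h.
Proof.
move=> /squareP[p1 p2]; apply: le_lt_trans (cabs_le_ReIm _) _.
by move: p1 p2; case: w => a b; case: p => x y /=; lra.
Qed.

Lemma cabs_lt_square w h p : cabs (cpt p - w) < h -> square w h p.
Proof.
move=> pw; apply/squareP; split; apply: le_lt_trans pw.
  by have := norm_Re_le (cpt p - w); case: w.
by have := norm_Im_le (cpt p - w); case: w.
Qed.

End PlaneMeasure.

(** * A dyadic kernel of bounded mass *)

Lemma powRV {R : realType} (x s : R) : 0 <= x -> x^-1 `^ s = x `^ (- s).
Proof. by move=> x0; rewrite -[x^-1]powR_inv1 // -powRrM mulN1r. Qed.

Lemma geometric_sum_le {R : realType} (a q : R) n : 0 <= a -> 0 <= q < 1 ->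
  \sum_(0 <= i < n) a * q ^+ i <= a / (1 - q).
Proof.
move=> a0 /andP[q0 q1].
suff -> : \sum_(0 <= i < n) a * q ^+ i = a * (1 - q ^+ n) / (1 - q).
  apply: ler_wpM2r; first by rewrite invr_ge0 subr_ge0 ltW.
  by rewrite ler_piMr // lerBlDr lerDl exprn_ge0.
have q1' : 1 - q != 0 by rewrite subr_eq0 eq_sym lt_eqF.
elim: n => [|n IHn]; first by rewrite big_geq // expr0 subrr mulr0 mul0r.
by rewrite big_nat_recr //= IHn exprS; field.
Qed.

Lemma dyadic_floor {R : realType} (t : R) : 1 <= t ->
  exists n, 2 ^+ n <= t < 2 ^+ n.+1.
Proof.
move=> t1; have ex : exists n, t < 2 ^+ n.
  exists (Num.truncn t).+1; have /andP[_ lt] := truncn_itv (le_trans ler01 t1).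
  apply: lt_trans lt _; rewrite -natrX ltr_nat; exact: ltn_expl.
case: (ex_minnP ex) => -[|n] nt nmin; first by move: nt; rewrite expr0; lra.
by exists n; rewrite nt andbT leNgt; apply/negP => /nmin; rewrite ltnn.
Qed.

Section DyadicKernel.
Local Open Scope classical_set_scope.
Context {R : realType} (kap : R) (kap0 : 0 < kap) (kap1 : kap <= 1).
Let q : R := 2 `^ (- kap).

Let q_gt0 : 0 < q. Proof. exact: powR_gt0. Qed.

Let q_lt1 : q < 1.
Proof.
rewrite /q powRN invf_lt1 ?powR_gt0 // -[ltLHS](powRr0 2).
by rewrite /powR ifF ?gt_eqF // ltr_expR mul0r mulr_gt0 // ln_gt0 // ltr1n.
Qed.

(** The bound [kap <= 1] enters here: it gives [4 * q >= 1], so the coefficients of the inner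
    squares do not decay. *)
Let q_ge : 1 / 2 <= q.
Proof.
by rewrite /q powRN div1r lef_pV2 ?posrE ?powR_gt0 // -[leRHS](@powRr1 _ 2) // ler_powR // ler1n.
Qed.

Let qX n : q ^+ n = (2 ^+ n) `^ (- kap).
Proof. by rewrite -powR_mulrn ?powR_ge0 // /q -powR_mulrn // -!powRrM mulrC. Qed.

Let pow4 n : 4 ^+ n = (2 ^+ n) ^+ 2 :> R.
Proof. by rewrite -exprM mulnC exprM; congr (_ ^+ n); rewrite expr2; lra. Qed.

(* The n-th layer dominates [u^-2 min((u/rho)^kap, (u/rho)^(-kap))], u the distance to
   [alpha], where u/rho is about 2^-n or 2^n, and its mass 80 q^n is independent of [rho]. *)
Definition layer (alpha : R[i]) (rho : R) (n : nat) (p : R * R) : \bar R :=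
  ((4 * rho ^- 2 * (4 * q) ^+ n)%:E * (\1_(square alpha (2 * rho / 2 ^+ n)) p)%:E +
   (rho ^- 2 * (q / 4) ^+ n)%:E * (\1_(square alpha (rho * 2 ^+ n.+1)) p)%:E)%E.

Definition dyadic_kernel alpha rho p : \bar R :=
  (\sum_(0 <= n <oo) layer alpha rho n p)%E.

Variables (alpha : R[i]) (rho : R) (rho0 : 0 < rho).

Let inner_ge0 n : 0 <= 4 * rho ^- 2 * (4 * q) ^+ n.
Proof. by rewrite !mulr_ge0 ?invr_ge0 ?exprn_ge0 // ?mulr_ge0 // ltW. Qed.

Let outer_ge0 n : 0 <= rho ^- 2 * (q / 4) ^+ n.
Proof. by rewrite !mulr_ge0 ?invr_ge0 ?exprn_ge0 // ?mulr_ge0 // ltW. Qed.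

Let indic_ge0 (A : set (R * R)) p : (0 <= (\1_A p)%:E :> \bar R)%E.
Proof. by rewrite lee_fin. Qed.

Lemma layer_ge0 n p : (0 <= layer alpha rho n p)%E.
Proof. by apply: adde_ge0; apply: mule_ge0 => //; rewrite lee_fin. Qed.

Let measurable_indic_square w (h : R) :
  measurable_fun [set: R * R] (fun p => (\1_(square w h) p)%:E : \bar R).
Proof. by apply/measurable_EFinP; apply: measurable_indic; exact: measurable_square. Qed.

Lemma measurable_layer n : measurable_fun [set: R * R] (layer alpha rho n).
Proof. by apply: emeasurable_funD; apply: measurable_funeM. Qed.

Lemma dyadic_kernel_ge0 p : (0 <= dyadic_kernel alpha rho p)%E.
Proof. by apply: nneseries_ge0 => n _ _; exact: layer_ge0. Qed.

Lemma measurable_dyadic_kernel : measurable_fun [set: R * R] (dyadic_kernel alpha rho).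
Proof.
apply: (ge0_emeasurable_sum (P := xpredT)) => [n p _ _|n _].
  exact: layer_ge0.
exact: measurable_layer.
Qed.

Lemma integral_layer n : (\int[@dV R]_p layer alpha rho n p = (80 * q ^+ n)%:E)%E.
Proof.
have mindic w (h : R) : 0 < h -> (\int[@dV R]_p (\1_(square w h) p)%:E = (4 * h ^+ 2)%:E)%E.
  by move=> h0; rewrite -(dV_square w h h0) /dV integral_indic ?setIT //; exact: measurable_square.
rewrite /dV ge0_integralD //; first last.
- exact: (measurable_funeM _ (measurable_indic_square _ _)).
- by move=> p _; apply: mule_ge0 => //; rewrite lee_fin.
- exact: (measurable_funeM _ (measurable_indic_square _ _)).
- by move=> p _; apply: mule_ge0 => //; rewrite lee_fin.
rewrite !ge0_integralZl_EFin //; try exact: measurable_indic_square.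
rewrite -/(@dV R) !mindic ?divr_gt0 ?mulr_gt0 ?exprn_gt0 //.
(* The inner square contributes 64 q^n and the outer one 16 q^n. *)
rewrite -!EFinM -EFinD; congr EFin.
have r0 : rho != 0 by rewrite gt_eqF.
have e0 : (2 : R) ^+ n != 0 by rewrite expf_neq0.
rewrite !exprMn !exprVn !pow4 [2 ^+ n.+1]exprS.
by move: (q ^+ n) e0 => x; move: (2 ^+ n) => e e0; field; rewrite ?r0 ?e0.
Qed.

(** The layers have geometric mass. That the bound involves neither [alpha] nor [rho] makes the
    final constant independent of P, Q and [Lambda]. *)
Lemma integral_dyadic_kernel_le :
  (\int[@dV R]_p dyadic_kernel alpha rho p <= (80 / (1 - q))%:E)%E.
Proof.
rewrite /dV integral_nneseries //; first last.
- by move=> n p _; exact: layer_ge0.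
- by move=> n; exact: measurable_layer.
apply: lime_le.
  by apply: is_cvg_nneseries => n _ _; apply: integral_ge0 => p _; exact: layer_ge0.
apply: nearW => n; under eq_bigr do rewrite -/(@dV R) integral_layer.
by rewrite sumEFin lee_fin geometric_sum_le // (ltW q_gt0) q_lt1.
Qed.

Lemma layer_le_dyadic_kernel n p : (layer alpha rho n p <= dyadic_kernel alpha rho p)%E.
Proof.
have := @nneseries_lim_ge _ (fun n => layer alpha rho n p) xpredT 0 n.+1.
move=> H; apply: le_trans (H _); last by move=> *; exact: layer_ge0.
rewrite big_nat_recr //= leeDr //; apply: sume_ge0 => i _; exact: layer_ge0.
Qed.

(** The integrand may be [+oo] at a root, so pointwise domination requires this. All inner squares
    contain the centre, with coefficients at least [4 * rho ^- 2], and the series diverges. *)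
Lemma dyadic_kernel_center p : cpt p = alpha -> dyadic_kernel alpha rho p = +oo%E.
Proof.
move=> pa; apply/eqyP => A A0.
have key n : ((n%:R * (4 * rho ^- 2))%:E <= dyadic_kernel alpha rho p)%E.
  apply: le_trans (nneseries_lim_ge n (fun i _ _ => layer_ge0 i p)).
  apply: (@le_trans _ _ (\sum_(0 <= i < n) (4 * rho ^- 2)%:E)%E).
    by rewrite sumEFin sumr_const_nat subn0 mulr_natl.
  apply: lee_sum => i _; rewrite /layer.
  have sq h : 0 < h -> \1_(square alpha h) p = 1 :> R.
    by move=> h0; rewrite indicE mem_set //; apply: cabs_lt_square; rewrite pa subrr cabs0.
  rewrite !sq ?divr_gt0 ?mulr_gt0 ?exprn_gt0 // !mule1 -EFinD lee_fin.
  rewrite -[leLHS]addr0 lerD // ler_peMr //.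
    by rewrite mulr_ge0 ?invr_ge0 ?sqr_ge0.
  by apply: exprn_ege1; move: q_ge; move: (q) => x; lra.
pose n := (Num.truncn (A * rho ^+ 2)).+1.
apply: le_trans (key n); rewrite lee_fin.
have /andP[_ lt] := truncn_itv (mulr_ge0 (ltW A0) (sqr_ge0 rho)).
have r2 : 0 < rho ^+ 2 by rewrite exprn_gt0.
rewrite mulrA ler_pdivlMr //; apply: le_trans (ltW lt) _.
by rewrite ler_peMr //; lra.
Qed.

(** A single layer suffices, the one with 2^n <= rho / u < 2^(n+1); its inner square contains the
    point. The outer case uses 2^n <= u / rho < 2^(n+1) and the outer square. *)
Lemma dyadic_kernel_inner p (u := cabs (cpt p - alpha)) : 0 < u -> u < rho ->
  ((u ^- 2 * (u / rho) `^ kap)%:E <= dyadic_kernel alpha rho p)%E.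
Proof.
move=> u0 ur; have [|n /andP[n1 n2]] := dyadic_floor (rho / u).
  by rewrite ler_pdivlMr // mul1r ltW.
have e0 : 0 < (2 : R) ^+ n by rewrite exprn_gt0.
have ru0 : 0 < rho / u by rewrite divr_gt0.
apply: le_trans (layer_le_dyadic_kernel n p); rewrite /layer.
rewrite (_ : \1_(square _ (_ / _)) p = 1); last first.
  rewrite indicE mem_set //.
  apply: cabs_lt_square; rewrite -/u ltr_pdivlMr // mulrC -ltr_pdivlMr // -mulrA.
  by apply: le_lt_trans n1 _; lra.
rewrite mule1; apply: le_trans (leeDl _ _); last first.
  by apply: mule_ge0 => //; rewrite lee_fin.
rewrite lee_fin exprMn qX mulrA; apply: ler_pM; rewrite ?powR_ge0 ?invr_ge0 ?sqr_ge0 //.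
  rewrite [leLHS](_ : _ = rho ^- 2 * (rho / u) ^+ 2); last by field; rewrite !gt_eqF.
  rewrite [leRHS](_ : _ = rho ^- 2 * (4 * 4 ^+ n)); last by rewrite -mulrA mulrCA.
  rewrite ler_pM2l ?invr_gt0 ?exprn_gt0 //.
  rewrite -exprS pow4 lerXn2r ?nnegrE ?(ltW ru0) ?(ltW n2) // exprn_ge0 //.
have -> : (u / rho) `^ kap = (rho / u) `^ (- kap).
  by rewrite -invf_div powRV ?(ltW ru0).
by rewrite !powRN lef_pV2 ?posrE ?powR_gt0 // ge0_ler_powR ?nnegrE ?(ltW kap0) ?(ltW e0) ?(ltW ru0).
Qed.

Lemma dyadic_kernel_outer p (u := cabs (cpt p - alpha)) : rho <= u ->
  ((u ^- 2 * (u / rho) `^ (- kap))%:E <= dyadic_kernel alpha rho p)%E.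
Proof.
move=> ru; have [|n /andP[n1 n2]] := dyadic_floor (u / rho).
  by rewrite ler_pdivlMr // mul1r.
have u0 : 0 < u by exact: lt_le_trans ru.
have e0 : 0 < (2 : R) ^+ n by rewrite exprn_gt0.
have ur0 : 0 < u / rho by rewrite divr_gt0.
apply: le_trans (layer_le_dyadic_kernel n p); rewrite /layer.
rewrite (_ : \1_(square _ (_ * 2 ^+ n.+1)) p = 1); last first.
  rewrite indicE mem_set //.
  by apply: cabs_lt_square; rewrite -/u mulrC -ltr_pdivrMr.
rewrite mule1; apply: le_trans (leeDr _ _); last first.
  by apply: mule_ge0 => //; rewrite lee_fin.
rewrite lee_fin exprMn qX exprVn [_ `^ _ / _]mulrC mulrA.
apply: ler_pM; rewrite ?powR_ge0 ?invr_ge0 ?sqr_ge0 //.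
  rewrite -invfM lef_pV2 ?posrE ?mulr_gt0 ?exprn_gt0 //.
  rewrite pow4 -exprMn.
  rewrite lerXn2r ?nnegrE ?mulr_ge0 ?(ltW u0) ?(ltW rho0) ?(ltW e0) //.
  by rewrite mulrC -ler_pdivlMr.
rewrite !powRN lef_pV2 ?posrE ?powR_gt0 // ge0_ler_powR ?nnegrE ?(ltW kap0) ?(ltW e0) ?(ltW ur0) //.
Qed.

End DyadicKernel.

(** * Real powers and the variation of the weight *)

Section RealPowers.
Context {R : realType}.
Implicit Types x y s : R.

Lemma powR_exprn x n s : 0 <= x -> (x ^+ n) `^ s = x `^ (n%:R * s).
Proof. by move=> x0; rewrite -powR_mulrn // powRrM. Qed.

Lemma powR_prod n (x : 'I_n -> R) s : (forall i, 0 <= x i) ->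
  (\prod_(i < n) x i) `^ s = \prod_(i < n) x i `^ s.
Proof.
move=> x0; suff [] : (\prod_(i < n) x i) `^ s = \prod_(i < n) x i `^ s /\
  0 <= \prod_(i < n) x i by [].
elim/big_rec2: _ => [|i a b _ [<- b0]]; first by rewrite powR1 ler01.
by rewrite powRM // mulr_ge0.
Qed.

Lemma ler_powRN x y s : 0 <= s -> 0 < x -> x <= y -> y `^ (- s) <= x `^ (- s).
Proof.
move=> s0 x0 xy; rewrite !powRN lef_pV2 ?posrE ?powR_gt0 //; last exact: lt_le_trans xy.
by rewrite ge0_ler_powR ?nnegrE ?(ltW x0) // (le_trans (ltW x0)).
Qed.

Lemma gt0_powRD x s t : 0 < x -> x `^ (s + t) = x `^ s * x `^ t.
Proof. by move=> x0; rewrite powRD // (gt_eqF x0) implybT. Qed.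

(** With t = u / rho <= 1, the hypothesis on [Drho] reads Du >= t^m Drho / A. The weight at [u] is
    then at most A^delta times its value at [rho] times t^(s - m delta), and that exponent is at
    least [kap]. *)
Lemma weight_inner_le (rho u s delta kap A Drho Du : R) (m : nat) :
  0 <= delta -> 0 < u -> u <= rho -> 0 < A -> 0 < Drho -> 0 < Du ->
  Drho <= A * (rho / u) ^+ m * Du -> kap <= s - m%:R * delta ->
  u `^ s * Du `^ (- delta) <=
    A `^ delta * (rho `^ s * Drho `^ (- delta)) * (u / rho) `^ kap.
Proof.
move=> d0 u0 ur A0 Dr0 Du0 DA ks; have r0 : 0 < rho by exact: lt_le_trans ur.
set t := u / rho; have t0 : 0 < t by rewrite divr_gt0.
have t1 : t <= 1 by rewrite ler_pdivrMr // mul1r.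
have Dle : A^-1 * t ^+ m * Drho <= Du.
  move: DA; rewrite -[rho / u]invf_div -/t exprVn -mulrA -ler_pdivrMl //.
  by rewrite -ler_pdivrMl ?invr_gt0 ?exprn_gt0 // invrK mulrA [t ^+ m * _]mulrC.
have D0 : 0 < A^-1 * t ^+ m * Drho by rewrite !mulr_gt0 ?invr_gt0 ?exprn_gt0.
apply: (@le_trans _ _ (u `^ s * (A^-1 * t ^+ m * Drho) `^ (- delta))).
  by rewrite ler_wpM2l ?powR_ge0 // ler_powRN.
have -> : u = t * rho by rewrite divfK // gt_eqF.
clearbody t.
rewrite !powRM ?mulr_ge0 ?invr_ge0 ?exprn_ge0 ?(ltW t0) ?(ltW r0) ?(ltW A0) ?(ltW Dr0) //.
rewrite powRV ?(ltW A0) // opprK powR_exprn ?(ltW t0) //.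
rewrite [leLHS](_ : _ = A `^ delta * (rho `^ s * Drho `^ (- delta)) *
  (t `^ s * t `^ (m%:R * - delta))); last by ring.
rewrite ler_wpM2l ?mulr_ge0 ?powR_ge0 // -gt0_powRD // mulrN.
by apply: ger_powR => //; rewrite t0 t1.
Qed.

Lemma weight_outer_le (rho u s delta kap Drho Du : R) (m : nat) :
  0 <= delta -> 0 < rho -> rho <= u -> 0 < Drho ->
  (u / rho) ^+ m * Drho <= Du -> s - m%:R * delta <= - kap ->
  u `^ s * Du `^ (- delta) <= rho `^ s * Drho `^ (- delta) * (u / rho) `^ (- kap).
Proof.
move=> d0 r0 ur Dr0 Dle ks; have u0 : 0 < u by exact: lt_le_trans ur.
set t := u / rho in Dle *; have t0 : 0 < t by rewrite divr_gt0.
have t1 : 1 <= t by rewrite ler_pdivlMr // mul1r.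
have D0 : 0 < t ^+ m * Drho by rewrite !mulr_gt0 ?exprn_gt0.
apply: (@le_trans _ _ (u `^ s * (t ^+ m * Drho) `^ (- delta))).
  by rewrite ler_wpM2l ?powR_ge0 // ler_powRN.
have -> : u = t * rho by rewrite divfK // gt_eqF.
clearbody t.
rewrite !powRM ?mulr_ge0 ?exprn_ge0 ?(ltW t0) ?(ltW r0) ?(ltW Dr0) //.
rewrite powR_exprn ?(ltW t0) //.
rewrite [leLHS](_ : _ = rho `^ s * Drho `^ (- delta) *
  (t `^ s * t `^ (m%:R * - delta))); last by ring.
rewrite ler_wpM2l ?mulr_ge0 ?powR_ge0 // -gt0_powRD // mulrN.
exact: ler_powR.
Qed.

End RealPowers.

(** * The critical index and the gap given by non-resonance *)

Section CriticalIndex.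
Context {R : realType} (eps delta : R) (M N : nat).
Hypothesis eps0 : 0 <= eps.
Hypothesis nonres : forall k nu : nat, (k <= N)%N -> (nu <= M)%N ->
  nu%:R * eps + 2 - (N - k)%:R * delta != 0.

(** [knu] would also be [None] if [pick] failed. Non-resonance excludes this: the largest [k]
    satisfying the upper inequality satisfies the lower one as well. *)
Lemma knu_None nu : (nu <= M)%N -> @knu R N eps delta nu = None ->
  N%:R * delta < nu%:R * eps + 2.
Proof.
move=> nuM; rewrite /knu; case: ifP => // /negbT; rewrite -leNgt => le.
case: pickP => // nok _; exfalso.
have lt0 : nu%:R * eps + 2 < (N - 0)%:R * delta.
  rewrite lt_neqAle subn0 le andbT -subr_eq0.
  by have := nonres 0%N nu (leq0n _) nuM; rewrite subn0.
(* Subtraction is truncated: for [k > N] the right-hand side is 0, below nu eps + 2. *)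
have ub k : nu%:R * eps + 2 < (N - k)%:R * delta -> (k <= N)%N.
  move=> lt; rewrite leqNgt; apply/negP => kN; move: lt.
  have -> : (N - k = 0)%N by lia.
  rewrite mul0r; have : 0 <= nu%:R * eps by rewrite mulr_ge0.
  by lra.
case: (ex_maxnP (ex_intro (fun k => nu%:R * eps + 2 < (N - k)%:R * delta) 0%N lt0) ub).
move=> k kP kmax; have kN : (k < N)%N.
  rewrite ltn_neqAle ub // andbT; apply/eqP => kN; move: kP; rewrite kN subnn mul0r.
  have : 0 <= nu%:R * eps by rewrite mulr_ge0.
  by lra.
have := nok (Ordinal kN); rewrite /= kP andbT => /negbT; rewrite -leNgt => le1.
suff : (k.+1 <= k)%N by rewrite ltnn.
have Nk : (N - k.+1 = N - k - 1)%N by lia.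
(* The failed lower inequality is strict by non-resonance, so [k.+1] satisfies the upper one,
   against maximality. *)
apply: kmax; rewrite Nk lt_neqAle le1 andbT -subr_eq0.
by have := nonres k.+1 nu kN nuM; rewrite Nk.
Qed.

Lemma knu_Some nu (k : 'I_N) : @knu R N eps delta nu = Some k ->
  (N - k - 1)%:R * delta < nu%:R * eps + 2 /\ nu%:R * eps + 2 < (N - k)%:R * delta.
Proof.
rewrite /knu; case: ifP => // _; case: pickP => // k' /andP[k1 k2] [<-].
by split.
Qed.

(** A minimum of finitely many positive numbers, capped at 1. It involves only [eps], [delta], [M]
    and [N]. *)
Lemma exists_resonance_gap : exists kap : R, [/\ 0 < kap, kap <= 1 &
  forall m nu : nat, (m <= N)%N -> (nu <= M)%N ->
    kap <= `|nu%:R * eps + 2 - m%:R * delta| ].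
Proof.
pose g (m : 'I_N.+1) (nu : 'I_M.+1) := `|nu%:R * eps + 2 - m%:R * delta|.
exists (\big[Num.min/1]_m \big[Num.min/1]_nu g m nu); split.
- apply: lt_bigmin => // m _; apply: lt_bigmin => // nu _; rewrite normr_gt0.
  have := nonres (N - m)%N nu (leq_subr _ _); rewrite subKn; last by rewrite -ltnS.
  by apply; rewrite -ltnS.
- exact: bigmin_le_id.
- move=> m nu; rewrite -ltnS => mN; rewrite -ltnS => nuM.
  by apply: (bigmin_inf (Ordinal mN)) => //; exact: (bigmin_inf (Ordinal nuM)).
Qed.

End CriticalIndex.

(** * The weight u^(nu eps + 2) D(u)^(-delta) and its peak *)

Section Weights.
Context {R : realType} (eps delta : R) (M N : nat).
Hypothesis eps0 : 0 <= eps.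
Hypothesis delta0 : 0 <= delta.
Hypothesis nonres : forall k nu : nat, (k <= N)%N -> (nu <= M)%N ->
  nu%:R * eps + 2 - (N - k)%:R * delta != 0.
Context (Lambda : R) (r : 'I_N -> R[i]) (Lambda0 : 0 < Lambda).
Hypothesis r_lt : forall i, cabs (r i) < Lambda / 2.
Variable j : 'I_N.
Notation alpha := (r j).
Notation D := (maxprod r alpha).
Notation expo nu := (nu%:R * eps + 2).
Notation Phi := (Phi r eps delta Lambda alpha).

Lemma dist_roots_lt a b : cabs (r a - r b) < Lambda.
Proof.
apply: le_lt_trans (cabs_triangle _ _) _; rewrite cabsN.
by have := r_lt a; have := r_lt b; lra.
Qed.

Lemma maxprod_large t : Lambda <= t -> D t = t ^+ N.
Proof.
move=> Lt; rewrite /maxprod -[X in _ ^+ X]card_ord -prodr_const.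
by apply: eq_bigr => i _; rewrite max_l // (le_trans (ltW (dist_roots_lt _ _))).
Qed.

Lemma Lk_lt_Lambda k : Lk r alpha k < Lambda.
Proof.
apply: le_lt_trans (Lk_le_diamT _ _ _) _; apply: diam_lt => // a b _ _.
exact: dist_roots_lt.
Qed.

(** In this form and the next, 1 / Phi is X^(nu eps + 2) E^(-delta), where X is the critical scale
    and E equals or is comparable with [D] at X. *)
Lemma Phi_NoneE nu : @knu R N eps delta nu = None ->
  Phi nu = Lambda `^ (- expo nu) * (Lambda ^+ N) `^ delta.
Proof.
move=> knuE; rewrite /Defs.Phi knuE addrC gt0_powRD // powR_exprn // ltW //.
Qed.

Lemma Phi_SomeE nu k : @knu R N eps delta nu = Some k -> 0 < Lk r alpha k ->
  Phi nu = Lk r alpha k `^ (- expo nu) * scaleprod r j k `^ delta.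
Proof.
move=> knuE L0; rewrite /Defs.Phi knuE addrC gt0_powRD // -mulrA /scaleprod powRM.
- by rewrite powR_exprn ?Lk_ge0 // powR_prod // => i; exact: Lk_ge0.
- by rewrite exprn_ge0 ?Lk_ge0.
- by apply: prodr_ge0 => i _; exact: Lk_ge0.
Qed.

(** The exponent of [Lk] is strictly positive, which matters since 0 to the power 0 is 1. *)
Lemma Phi_Some0 nu (k : 'I_N) : @knu R N eps delta nu = Some k -> Lk r alpha k = 0 ->
  Phi nu = 0.
Proof.
move=> knuE L0; have [_ lt] := knu_Some _ _ _ _ _ knuE.
by rewrite /Defs.Phi knuE L0 powR0 ?mul0r // gt_eqF // subr_gt0.
Qed.

Lemma Phi_ge0 nu : 0 <= Phi nu.
Proof.
rewrite /Defs.Phi; case: knu => [k|]; last exact: powR_ge0.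
by rewrite mulr_ge0 ?powR_ge0 // prodr_ge0 // => i _; exact: powR_ge0.
Qed.

(* [2 * Lambda] plays the role of the missing scale [L_(-1)]. *)
Definition peak_radius nu : R :=
  if @knu R N eps delta nu is Some k then Lk r alpha k else 2 * Lambda.

Lemma peak_radius_gt0 nu : Phi nu != 0 -> 0 < peak_radius nu.
Proof.
rewrite /peak_radius; case knuE: knu => [k|] Phi0; last by rewrite mulr_gt0.
rewrite lt_neqAle Lk_ge0 andbT eq_sym; apply: contra Phi0 => /eqP L0.
by rewrite (Phi_Some0 _ k).
Qed.

(** The first factor pays for [maxprod_doubling]. In the sum, the first term pays for
    [scaleprod_le_maxprod] and the second for using [2 * Lambda] in place of [Lambda]. *)
Definition peak_cst : R :=
  2 `^ (N%:R * delta) * (2 `^ ((N * N)%:R * delta) + 2 `^ (M%:R * eps + 2)).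

Lemma peak_value_le nu : (nu <= M)%N -> Phi nu != 0 ->
  2 `^ (N%:R * delta) * (peak_radius nu `^ (expo nu) * D (peak_radius nu) `^ (- delta)) <=
  peak_cst / Phi nu.
Proof.
move=> nuM Phi0; have := peak_radius_gt0 _ Phi0.
rewrite /peak_radius /peak_cst -mulrA ler_pM2l ?powR_gt0 //; case knuE: knu => [k|] rho0.
  have Sk0 : 0 < scaleprod r j k.
    by apply: lt_le_trans (maxprod_le_scaleprod _ _ _ _ rho0) => //; exact: maxprod_gt0.
  rewrite (Phi_SomeE _ k) // invfM -!powRN opprK.
  rewrite [leRHS]mulrCA ler_wpM2l ?powR_ge0 // [leRHS]mulrC.
  have SD := scaleprod_le_maxprod r j k (ltn_ord k) rho0.
  have twoX (n : nat) : 0 < (2 : R) ^+ n by rewrite exprn_gt0.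
  have SD' : scaleprod r j k / 2 ^+ (N * N) <= D (Lk r alpha k).
    rewrite ler_pdivrMr // mulrC; apply: le_trans SD _.
    apply: ler_wpM2r; first by rewrite ltW // maxprod_gt0.
    by rewrite ler_weXn2l ?ler1n // leq_mul2l ltnW ?orbT.
  apply: (@le_trans _ _ ((scaleprod r j k / 2 ^+ (N * N)) `^ (- delta))).
    by rewrite ler_powRN // divr_gt0.
  rewrite powRM ?invr_ge0 ?(ltW Sk0) ?(ltW (twoX _)) //.
  rewrite powRV ?(ltW (twoX _)) // opprK powR_exprn // ler_wpM2l ?powR_ge0 //.
  by rewrite lerDl powR_ge0.
(* Without a critical index, the value at [2 * Lambda] is 2^(nu eps + 2 - N delta) / Phi. *)
have lt := knu_None _ _ _ _ eps0 nonres _ nuM knuE.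
rewrite Phi_NoneE // maxprod_large; last by lra.
rewrite invfM -!powRN opprK !powR_exprn ?(ltW Lambda0) ?mulr_ge0 ?(ltW Lambda0) //.
rewrite !mulrN -!gt0_powRD ?mulr_gt0 // powRM ?(ltW Lambda0) //.
rewrite ler_wpM2r ?powR_ge0 //.
apply: (@le_trans _ _ (2 `^ (M%:R * eps + 2))); last by rewrite lerDr powR_ge0.
apply: ler_powR; first by rewrite ler1n.
have : nu%:R * eps <= M%:R * eps by rewrite ler_wpM2r // ler_nat.
have : 0 <= N%:R * delta by rewrite mulr_ge0.
by lra.
Qed.

Variable kap : R.
Hypothesis kap_gap : forall m nu : nat, (m <= N)%N -> (nu <= M)%N ->
  kap <= `|nu%:R * eps + 2 - m%:R * delta|.

Lemma weight_inner nu u : (nu <= M)%N -> Phi nu != 0 -> 0 < u -> u < peak_radius nu ->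
  u `^ (expo nu) * D u `^ (- delta) <=
  peak_cst / Phi nu * (u / peak_radius nu) `^ kap.
Proof.
move=> nuM Phi0 u0 ur; have rho0 := peak_radius_gt0 _ Phi0.
(* [m] bounds the number of roots closer than half the peak radius: [N - k - 1] for a critical index
   [k], and [N] when there is none. Either way the weight grows with exponent at least nu eps + 2 -
   m delta. *)
have [m [mN card_lt gap]] : exists m : nat, [/\ (m <= N)%N,
   (#|[set i | (cabs (alpha - r i) < peak_radius nu / 2)%R]| <= m)%N &
   m%:R * delta < expo nu].
  rewrite /peak_radius; case knuE: knu => [k|].
    exists (N - k - 1)%N; split; first by lia.
      exact: card_dist_lt_Lk.
    by have [] := knu_Some _ _ _ _ _ knuE.
  exists N; split => //; first by rewrite -[leqRHS]card_ord max_card.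
  exact: (knu_None _ _ _ _ eps0 nonres _ nuM).
have gap' : kap <= expo nu - m%:R * delta.
  by have := kap_gap m nu mN nuM; rewrite gtr0_norm // subr_gt0.
have Ddoub := maxprod_doubling r alpha _ _ _ u0 (ltW ur) card_lt.
have two0 : 0 < (2 : R) ^+ N by rewrite exprn_gt0.
have := weight_inner_le _ _ _ _ _ _ _ _ _ delta0 u0 (ltW ur) two0
  (maxprod_gt0 r alpha _ rho0) (maxprod_gt0 r alpha _ u0) Ddoub gap'.
move=> /le_trans -> //; apply: ler_wpM2r; first exact: powR_ge0.
by rewrite powR_exprn // peak_value_le.
Qed.

Lemma weight_outer nu u : (nu <= M)%N -> Phi nu != 0 -> peak_radius nu <= u ->
  u < 2 * Lambda ->
  u `^ (expo nu) * D u `^ (- delta) <=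
  peak_cst / Phi nu * (u / peak_radius nu) `^ (- kap).
Proof.
move=> nuM Phi0 ru uL; have rho0 := peak_radius_gt0 _ Phi0.
(* Without a critical index the radius is [2 * Lambda] and the outer range is empty. *)
case knuE: (@knu R N eps delta nu) => [k|]; last first.
  by move: ru; rewrite /peak_radius knuE; lra.
have [_ gap] := knu_Some _ _ _ _ _ knuE.
have rhoE : peak_radius nu = Lk r alpha k by rewrite /peak_radius knuE.
have gap' : expo nu - (N - k)%:R * delta <= - kap.
  have := kap_gap (N - k)%N nu (leq_subr _ _) nuM.
  by rewrite ltr0_norm ?subr_lt0 //; lra.
have card_le : (N - k <= #|[set i | (cabs (alpha - r i) <= peak_radius nu)%R]|)%N.
  by rewrite rhoE; exact: card_dist_le_Lk.
have Dgrow := maxprod_growth r alpha _ _ _ rho0 ru card_le.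
have := weight_outer_le _ _ _ _ _ _ _ _ delta0 rho0 ru
  (maxprod_gt0 r alpha _ rho0) Dgrow gap'.
move=> /le_trans -> //; apply: ler_wpM2r; first exact: powR_ge0.
apply: le_trans (peak_value_le _ nuM Phi0).
rewrite ler_peMl ?mulr_ge0 ?powR_ge0 // -[leLHS](powRr0 2) ler_powR ?ler1n //.
by rewrite mulr_ge0.
Qed.

End Weights.

(** * The modulus of Q near its nearest root *)

Section NearestRoot.
Context {R : realType} {N : nat} (r : 'I_N -> R[i]).
Notation Q := (\prod_(i < N) ('X - (r i)%:P)).

Lemma cabs_prod_XsubC z : cabs Q.[z] = \prod_(i < N) cabs (z - r i).
Proof.
rewrite horner_prod cabs_prod; apply: eq_bigr => i _; by rewrite hornerXsubC.
Qed.

Lemma exists_nearest_root z : (0 < N)%N ->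
  exists j, forall i, cabs (z - r j) <= cabs (z - r i).
Proof.
move=> N0; pose j0 : 'I_N := Ordinal N0.
case: (arg_minP (fun i => cabs (z - r i)) (isT : xpredT j0)) => j _ jmin.
by exists j => i; exact: jmin.
Qed.

(** As [r j] is nearest, |r j - r i| <= |r j - z| + |z - r i| <= 2 |z - r i|, so each factor costs
    at most 2. *)
Lemma maxprod_nearest_le z j : (forall i, cabs (z - r j) <= cabs (z - r i)) ->
  maxprod r (r j) (cabs (z - r j)) <= 2 ^+ N * cabs Q.[z].
Proof.
move=> jmin; rewrite cabs_prod_XsubC -[X in 2 ^+ X]card_ord -prodr_const -big_split /=.
apply: ler_prod => i _; rewrite le_max cabs_ge0 /= ge_max; apply/andP; split.
  by have := jmin i; have := cabs_ge0 (z - r i); lra.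
have := cabs_dist_triangle z (r j) (r i); rewrite [cabs (r j - z)]cabsC.
by have := jmin i; lra.
Qed.

Lemma cabs_prod_le_maxprod z alpha rho : cabs (z - alpha) <= rho ->
  cabs Q.[z] <= 2 ^+ N * maxprod r alpha rho.
Proof.
move=> zr; rewrite cabs_prod_XsubC -[X in 2 ^+ X]card_ord -prodr_const -big_split /=.
apply: ler_prod => i _; rewrite cabs_ge0 /=.
apply: le_trans (cabs_dist_triangle alpha _ _) _.
have h1 : rho <= Num.max rho (cabs (alpha - r i)) by rewrite le_max lexx.
have h2 : cabs (alpha - r i) <= Num.max rho (cabs (alpha - r i)).
  by rewrite le_max lexx orbT.
lra.
Qed.

End NearestRoot.

(** * Bounding the right-hand side by its terms and conversely *)

Section RightHandSide.
Context {R : realType} (eps delta Lambda : R) (M N : nat) (r : 'I_N -> R[i]).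
Variable P : {poly R[i]}.
Local Open Scope ereal_scope.

Lemma rhs_term_ge0 j nu : 0 <= rhs_term r eps delta Lambda P (r j) nu.
Proof.
rewrite /rhs_term; case: ifP => // _; rewrite lee_fin divr_ge0 ?powR_ge0 //.
exact: Phi_ge0.
Qed.

Lemma root_sum_le_rhs j :
  \sum_(nu < M.+1 | ((P^`(nu)).[r j] != 0)%R) rhs_term r eps delta Lambda P (r j) nu
    <= rhs r eps delta Lambda M P.
Proof.
have jS : r j \in undup [seq r i | i <- enum 'I_N].
  by rewrite mem_undup; apply: map_f; rewrite mem_enum.
rewrite /rhs (bigD1_seq (r j)) ?undup_uniq //=.
rewrite leeDl // big_seq_cond; apply: sume_ge0 => a /andP[ain _].
move: ain; rewrite mem_undup => /mapP[i _ ->].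
by apply: sume_ge0 => nu _; exact: rhs_term_ge0.
Qed.

Lemma rhs_ge0 : 0 <= rhs r eps delta Lambda M P.
Proof.
rewrite /rhs big_seq_cond; apply: sume_ge0 => a /andP[ain _].
move: ain; rewrite mem_undup => /mapP[i _ ->].
by apply: sume_ge0 => nu _; exact: rhs_term_ge0.
Qed.

Lemma rhs_term_le_rhs j nu : (nu <= M)%N -> (P^`(nu)).[r j] != 0%R ->
  rhs_term r eps delta Lambda P (r j) nu <= rhs r eps delta Lambda M P.
Proof.
rewrite -ltnS => nuM P0; apply: le_trans (root_sum_le_rhs j).
rewrite (bigD1 (Ordinal nuM)) //= leeDl //.
by apply: sume_ge0 => i _; exact: rhs_term_ge0.
Qed.

Lemma sume_le_const (I : eqType) (s : seq I) (p : pred I) (F : I -> \bar R) x :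
  0 <= x -> (forall i, i \in s -> p i -> F i <= x) ->
  \sum_(i <- s | p i) F i <= (size s)%:R%:E * x.
Proof.
move=> x0; elim: s => [|i s IHs] Fx; first by rewrite big_nil mul0e.
have IH : \sum_(i <- s | p i) F i <= (size s)%:R%:E * x.
  by apply: IHs => k ks; apply: Fx; rewrite inE ks orbT.
rewrite big_cons /= -natr1 EFinD ge0_muleDl ?lee_fin // mul1e addeC.
case: ifPn => pi; last by apply: le_trans IH _; rewrite leeDl.
by apply: leeD => //; apply: Fx => //; rewrite inE eqxx.
Qed.

Lemma sume_ord_le_const n (p : pred 'I_n) (F : 'I_n -> \bar R) x :
  0 <= x -> (forall i, p i -> F i <= x) -> \sum_(i < n | p i) F i <= n%:R%:E * x.
Proof.
move=> x0 Fx; have := @sume_le_const _ (index_enum 'I_n) p F x x0 (fun i _ => Fx i).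
by rewrite {2}/index_enum -enumT size_enum_ord.
Qed.

Lemma rhs_le_const x : 0 <= x ->
  (forall j nu, (nu <= M)%N -> (P^`(nu)).[r j] != 0%R ->
     rhs_term r eps delta Lambda P (r j) nu <= x) ->
  rhs r eps delta Lambda M P <= (N%:R * M.+1%:R)%:E * x.
Proof.
move=> x0 tx; rewrite EFinM -muleA /rhs.
set S := undup _; have SN : (size S <= N)%N.
  by apply: leq_trans (size_undup _) _; rewrite size_map size_enum_ord.
apply: (@le_trans _ _ ((size S)%:R%:E * (M.+1%:R%:E * x))); last first.
  by rewrite lee_wpmul2r ?mule_ge0 ?lee_fin ?ler_nat.
apply: sume_le_const; first by rewrite mule_ge0 // lee_fin.
move=> a; rewrite mem_undup => /mapP[j _ ->] _.
apply: sume_ord_le_const => // nu; apply: tx; by rewrite -ltnS.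
Qed.

End RightHandSide.

(** * The upper bound for the integral, when no [Phi] in the sum vanishes *)

Section UpperBound.
Context {R : realType} (eps delta : R) (M N : nat).
Hypothesis eps0 : 0 <= eps.
Hypothesis delta0 : 0 <= delta.
Hypothesis N0 : (0 < N)%N.
Hypothesis nonres : forall k nu : nat, (k <= N)%N -> (nu <= M)%N ->
  nu%:R * eps + 2 - (N - k)%:R * delta != 0.
Variable kap : R.
Hypothesis kap0 : 0 < kap.
Hypothesis kap1 : kap <= 1.
Hypothesis kap_gap : forall m nu : nat, (m <= N)%N -> (nu <= M)%N ->
  kap <= `|nu%:R * eps + 2 - m%:R * delta|.
Context (Lambda : R) (r : 'I_N -> R[i]) (P : {poly R[i]}) (Lambda0 : 0 < Lambda).
Hypothesis r_lt : forall i, cabs (r i) < Lambda / 2.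
Hypothesis sP : size P = M.+1.
Notation Q := (\prod_(i < N) ('X - (r i)%:P)).
Notation Phi j := (Phi r eps delta Lambda (r j)).
Hypothesis Phi0 : forall j nu, (nu <= M)%N -> (P^`(nu)).[r j] != 0 -> Phi j nu != 0.

(** The value 0 for a vanishing derivative annihilates the kernel even where its radius may be 0, so
    the sums below need no condition on [nu]. *)
Let coef j nu : R :=
  if (P^`(nu)).[r j] != 0 then cabs (P^`(nu)).[r j] `^ eps / Phi j nu else 0.

Let kernel j nu : R * R -> \bar R :=
  dyadic_kernel kap (r j) (peak_radius eps delta N Lambda r j nu).

Let dom_cst : R := M.+1%:R `^ eps * 2 `^ (N%:R * delta) * peak_cst eps delta M N.

(** No integration over nearest-root cells takes place: the row of the nearest root bounds the
    integrand pointwise and the other rows are nonnegative. *)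
Let dominant p : \bar R :=
  (\sum_(j < N) \sum_(nu < M.+1) (dom_cst * coef j nu)%:E * kernel j nu p)%E.

Let dom_cst_gt0 : 0 < dom_cst.
Proof. by rewrite /dom_cst /peak_cst !mulr_gt0 ?addr_gt0 ?powR_gt0. Qed.

Let coef_ge0 j nu : 0 <= coef j nu.
Proof. by rewrite /coef; case: ifP => // _; rewrite divr_ge0 ?powR_ge0 ?Phi_ge0. Qed.

Let dcoef_ge0 j nu : 0 <= dom_cst * coef j nu.
Proof. by rewrite mulr_ge0 // ltW. Qed.

Let radius_gt0 j nu : (nu <= M)%N -> (P^`(nu)).[r j] != 0 ->
  0 < peak_radius eps delta N Lambda r j nu.
Proof. by move=> nuM P0; apply: peak_radius_gt0 => //; exact: Phi0. Qed.

Let term_ge0 j (nu : 'I_M.+1) p : (0 <= (dom_cst * coef j nu)%:E * kernel j nu p)%E.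
Proof.
have [P0|P0] := boolP ((P^`(nu)).[r j] != 0).
  apply: mule_ge0; first by rewrite lee_fin.
  by apply: dyadic_kernel_ge0 => //; apply: radius_gt0 => //; rewrite -ltnS.
by rewrite /coef (negbTE P0) mulr0 mul0e.
Qed.

Let cabs_horner_powR_le j z (u := cabs (z - r j)) :
  cabs P.[z] `^ eps <= M.+1%:R `^ eps *
    \sum_(nu < M.+1 | (P^`(nu)).[r j] != 0)
       cabs (P^`(nu)).[r j] `^ eps * u `^ (nu%:R * eps).
Proof.
have u0 : 0 <= u by exact: cabs_ge0.
pose x (nu : 'I_M.+1) := cabs (P^`(nu)).[r j] * u ^+ nu.
have x0 nu : 0 <= x nu by rewrite mulr_ge0 ?exprn_ge0 ?cabs_ge0.
apply: (@le_trans _ _ ((\sum_(nu < M.+1 | (P^`(nu)).[r j] != 0) x nu) `^ eps)).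
  rewrite ge0_ler_powR ?nnegrE ?cabs_ge0 ?sumr_ge0 //.
  have := cabs_horner_le P (r j) z; rewrite sP => /le_trans; apply.
  rewrite [leRHS]big_mkcond; apply: ler_sum => nu _.
  by case: eqVneq => //= ->; rewrite cabs0 mul0r.
apply: le_trans (powR_sum_le _ _ _ _ eps0 _ x0) _.
  by exists ord_max; exact: derivn_lead_neq0.
rewrite ler_wpM2l ?powR_ge0 //; apply: ler_sum => nu _.
by rewrite /x powRM ?exprn_ge0 ?cabs_ge0 // powR_exprn.
Qed.

Let term_le j nu p (u := cabs (cpt p - r j)) : (nu <= M)%N ->
  (P^`(nu)).[r j] != 0 -> 0 < u -> u < 2 * Lambda ->
  ((M.+1%:R `^ eps * 2 `^ (N%:R * delta) *
   (cabs (P^`(nu)).[r j] `^ eps * u `^ (nu%:R * eps)) * maxprod r (r j) u `^ (- delta))%:E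
   <= (dom_cst * coef j nu)%:E * kernel j nu p)%E.
Proof.
move=> nuM P0 u0 uL; have Ph0 := Phi0 _ _ nuM P0; have rho0 := radius_gt0 _ _ nuM P0.
set rho := peak_radius _ _ _ _ _ _ _ in rho0.
pose b := M.+1%:R `^ eps * 2 `^ (N%:R * delta) * cabs (P^`(nu)).[r j] `^ eps * u ^- 2.
have b0 : 0 <= b by rewrite !mulr_ge0 ?powR_ge0 ?invr_ge0 ?exprn_ge0 // ltW.
set lhs := (X in (X%:E <= _)%E).
have lhsE : lhs = b * (u `^ (nu%:R * eps + 2) * maxprod r (r j) u `^ (- delta)).
  rewrite /lhs /b gt0_powRD // (powR_mulrn 2 (ltW u0)).
  by field; rewrite gt_eqF.
(* The factor u^-2 is split off for the kernel; [y] will be (u / rho)^kap inside the peak radius and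
   (u / rho)^(-kap) outside. *)
have key y : u `^ (nu%:R * eps + 2) * maxprod r (r j) u `^ (- delta) <=
    peak_cst eps delta M N / Phi j nu * y -> ((u ^- 2 * y)%:E <= kernel j nu p)%E ->
    (lhs%:E <= (dom_cst * coef j nu)%:E * kernel j nu p)%E.
  move=> wy yK; apply: (@le_trans _ _ ((dom_cst * coef j nu)%:E * (u ^- 2 * y)%:E)%E).
    rewrite -EFinM lee_fin lhsE; apply: le_trans (ler_wpM2l b0 wy) _.
    by rewrite /b /coef P0 /dom_cst le_eqVlt; apply/orP; left; apply/eqP; ring.
  by rewrite lee_wpmul2l // lee_fin.
have [ur|ru] := ltP u rho.
  apply: key (weight_inner _ _ _ _ eps0 delta0 nonres _ _ Lambda0 r_lt _ _ kap_gap
    _ _ nuM Ph0 u0 ur) _.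
  exact: dyadic_kernel_inner.
apply: key (weight_outer _ _ _ _ eps0 delta0 nonres _ _ Lambda0 r_lt _ _ kap_gap
  _ _ nuM Ph0 ru uL) _.
exact: dyadic_kernel_outer.
Qed.

Let integrand_le_dominant p : disk Lambda p ->
  (integrand eps delta P Q p <= dominant p)%E.
Proof.
move=> pL; have [j jmin] := exists_nearest_root r (cpt p) N0.
apply: (@le_trans _ _ (\sum_(nu < M.+1) (dom_cst * coef j nu)%:E * kernel j nu p)%E);
  last first.
  rewrite /dominant (bigD1 j) //= leeDl //.
  by apply: sume_ge0 => i _; apply: sume_ge0 => nu _; exact: term_ge0.
set u := cabs (cpt p - r j).
have u_ge0 : 0 <= u by exact: cabs_ge0.
have uL : u < 2 * Lambda.
  apply: le_lt_trans (cabs_triangle _ _) _; rewrite cabsN.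
  by apply: lt_trans (ltrD (pL : cabs (cpt p) < Lambda) (r_lt j)) _; move: Lambda0; lra.
(* At the root itself the term of order [M] is already infinite: its coefficient is positive. *)
have [u0|u0] := eqVneq u 0.
  have PM : (P^`(M)).[r j] != 0 by exact: derivn_lead_neq0.
  rewrite (bigD1 ord_max) //= /kernel dyadic_kernel_center //; last first.
  - by apply/eqP; rewrite -subr_eq0 -cabs_eq0; apply/eqP.
  - exact: radius_gt0.
  rewrite gt0_muley ?addye ?leey //; last first.
    rewrite lte_fin mulr_gt0 // /coef PM divr_gt0 ?powR_gt0 //.
      by rewrite lt_neqAle cabs_ge0 andbT eq_sym cabs_eq0.
    by rewrite lt_neqAle Phi_ge0 andbT eq_sym Phi0.
  by rewrite gt_eqF // (lt_le_trans ltNy0) //; apply: sume_ge0 => nu _; exact: term_ge0.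
have {}u0 : 0 < u by rewrite lt_neqAle eq_sym u0.
set D := maxprod r (r j) u; have D0 : 0 < D by exact: maxprod_gt0.
have two0 : 0 < (2 : R) ^+ N by rewrite exprn_gt0.
have DQ : D / 2 ^+ N <= cabs Q.[cpt p].
  by rewrite ler_pdivrMr // mulrC; exact: maxprod_nearest_le.
have Q0 : 0 < cabs Q.[cpt p] by apply: lt_le_trans DQ; rewrite divr_gt0.
rewrite /integrand gt_eqF ?powR_gt0 //.
pose w (nu : 'I_M.+1) := M.+1%:R `^ eps * 2 `^ (N%:R * delta) *
   (cabs (P^`(nu)).[r j] `^ eps * u `^ (nu%:R * eps)) * D `^ (- delta).
apply: (@le_trans _ _ (\sum_(nu < M.+1 | (P^`(nu)).[r j] != 0) w nu)%:E).
  rewrite lee_fin -powRN.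
  apply: (@le_trans _ _ (cabs P.[cpt p] `^ eps * (D / 2 ^+ N) `^ (- delta))).
    by rewrite ler_wpM2l ?powR_ge0 // ler_powRN // divr_gt0.
  apply: le_trans (ler_wpM2r (powR_ge0 _ _) (cabs_horner_powR_le j _)) _.
  rewrite powRM ?invr_ge0 ?(ltW D0) ?(ltW two0) // powRV ?(ltW two0) // opprK powR_exprn //.
  rewrite mulr_sumr mulr_suml; apply: ler_sum => nu _.
  by rewrite /w -/u -/D le_eqVlt; apply/orP; left; apply/eqP; ring.
rewrite -sumEFin big_mkcond; apply: lee_sum => nu _.
by case: ifP => [P0|_]; [apply: term_le => //; rewrite -ltnS | exact: term_ge0].
Qed.

Let integral_term_le j (nu : 'I_M.+1) :
  (\int[@dV R]_(p in disk Lambda) ((dom_cst * coef j nu)%:E * kernel j nu p) <=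
   (80 / (1 - 2 `^ (- kap)) * (dom_cst * coef j nu))%:E)%E.
Proof.
have [P0|P0] := boolP ((P^`(nu)).[r j] != 0); last first.
  rewrite /coef (negbTE P0) !mulr0; under eq_integral do rewrite mul0e.
  by rewrite integral0.
have nuM : (nu <= M)%N by rewrite -ltnS.
have rho0 := radius_gt0 _ _ nuM P0.
have K0 p : (0 <= kernel j nu p)%E by exact: dyadic_kernel_ge0.
have mK : measurable_fun setT (kernel j nu) by exact: measurable_dyadic_kernel.
have mKd : measurable_fun (disk Lambda) (kernel j nu).
  exact: measurable_funS mK.
have mD := @measurable_disk R Lambda.
rewrite /dV ge0_integralZl_EFin //.
rewrite [X in (_ <= X)%E]EFinM [X in (_ <= X)%E]muleC.
apply: lee_wpmul2l; first by rewrite lee_fin.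
apply: le_trans (integral_dyadic_kernel_le _ kap0 (r j) _ rho0).
by apply: ge0_subset_integral.
Qed.

Lemma lhs_le_rhs_finite :
  (lhs eps delta Lambda P Q <=
   (N%:R * (80 / (1 - 2 `^ (- kap)) * dom_cst))%:E * rhs r eps delta Lambda M P)%E.
Proof.
have mD := @measurable_disk R Lambda.
have mterm j (nu : 'I_M.+1) : measurable_fun (disk Lambda)
    (fun p => (dom_cst * coef j nu)%:E * kernel j nu p)%E.
  have [P0|P0] := boolP ((P^`(nu)).[r j] != 0); last first.
    rewrite /coef (negbTE P0) !mulr0; under eq_fun do rewrite mul0e.
    exact: measurable_cst.
  have rho0 : 0 < peak_radius eps delta N Lambda r j nu.
    by apply: radius_gt0 => //; rewrite -ltnS.
  apply: measurable_funeM; apply: measurable_funS (measurable_dyadic_kernel _ _ _ rho0) => //.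
have mrow j : measurable_fun (disk Lambda)
    (fun p => \sum_(nu < M.+1) (dom_cst * coef j nu)%:E * kernel j nu p)%E.
  by apply: emeasurable_sum => nu; exact: mterm.
have q1 : 0 < 1 - 2 `^ (- kap).
  rewrite subr_gt0 powRN invf_lt1 ?powR_gt0 // -[ltLHS](powRr0 2).
  by rewrite /powR ifF ?gt_eqF // ltr_expR mul0r mulr_gt0 // ln_gt0 // ltr1n.
have mf := measurable_funS measurableT (@subsetT _ _) (measurable_integrand eps delta P Q).
apply: (@le_trans _ _ (\int[@dV R]_(p in disk Lambda) dominant p)%E).
  apply: ge0_le_integral.
  - exact: mD.
  - by move=> p _; exact: integrand_ge0.
  - exact: mf.
  - by apply: emeasurable_sum => j; exact: mrow.
  - exact: integrand_le_dominant.
rewrite /dominant /dV ge0_integral_sum; first last.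
- by move=> j p _; apply: sume_ge0 => nu _; exact: term_ge0.
- exact: mrow.
- exact: mD.
rewrite -/(@dV R).
have C0 : 0 <= 80 / (1 - 2 `^ (- kap)) * dom_cst by rewrite mulr_ge0 ?divr_ge0 // ltW.
(* Rows count roots with multiplicity, the right-hand side only distinct ones. Bounding each row by
   the whole right-hand side costs the factor N. *)
rewrite EFinM -muleA; apply: sume_ord_le_const => [|j _].
  by rewrite mule_ge0 ?lee_fin ?rhs_ge0.
rewrite /dV ge0_integral_sum; first last.
- by move=> nu p _; exact: term_ge0.
- exact: mterm.
- exact: mD.
rewrite -/(@dV R).
apply: (@le_trans _ _ (\sum_(nu < M.+1)
   (80 / (1 - 2 `^ (- kap)) * dom_cst)%:E * (coef j nu)%:E)%E).
  apply: lee_sum => nu _; rewrite -[X in (_ <= X)%E]EFinM -[X in (_ <= X%:E)%E]mulrA.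
  exact: integral_term_le.
rewrite -ge0_sume_distrr; last by move=> nu _; rewrite lee_fin.
apply: lee_wpmul2l; first by rewrite lee_fin.
apply: le_trans (root_sum_le_rhs _ _ _ _ _ _ _ j).
rewrite [leRHS]big_mkcond; apply: lee_sum => nu _; rewrite /coef.
case: ifP => // P0; rewrite /rhs_term ifF //.
by apply/negbTE/Phi0 => //; rewrite -ltnS.
Qed.

End UpperBound.

(** * The lower bound for the integral *)

Section LowerBound.
Context {R : realType} (eps delta : R) (M N : nat).
Hypothesis eps0 : 0 <= eps.
Hypothesis delta0 : 0 <= delta.
Hypothesis nonres : forall k nu : nat, (k <= N)%N -> (nu <= M)%N ->
  nu%:R * eps + 2 - (N - k)%:R * delta != 0.
Context (Lambda : R) (r : 'I_N -> R[i]) (P : {poly R[i]}) (Lambda0 : 0 < Lambda).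
Hypothesis r_lt : forall i, cabs (r i) < Lambda / 2.
Hypothesis sP : size P = M.+1.
Notation Q := (\prod_(i < N) ('X - (r i)%:P)).
Notation lhs := (lhs eps delta Lambda P Q).
Notation Phi j := (Phi r eps delta Lambda (r j)).
Notation D j := (maxprod r (r j)).
Notation expo nu := (nu%:R * eps + 2).

Lemma lhs_ge0 : (0 <= lhs)%E.
Proof. by apply: integral_ge0 => p _; exact: integrand_ge0. Qed.

(** The three factors come from the lower bound for |P|, from |Q| <= 2^N D, and from the area h^2 of
    the square against rho^2. *)
Definition weight_cst : R :=
  (M`!%:R * (8 * M%:R + 9) ^+ M) `^ eps * 2 `^ (N%:R * delta) * (4 * M.+1%:R) ^+ 2.

Lemma weight_cst_gt0 : 0 < weight_cst.
Proof.
have c0 : 0 < 8 * M%:R + 9 :> R by rewrite ltr_wpDl ?mulr_ge0.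
by rewrite /weight_cst !mulr_gt0 ?powR_gt0 ?exprn_gt0 ?mulr_gt0 ?exprn_gt0 ?ltr0n ?fact_gt0.
Qed.

Lemma weight_le_lhs j nu rho : (nu <= M)%N -> 0 < rho -> rho <= Lambda / 2 ->
  ((cabs (P^`(nu)).[r j] `^ eps * (rho `^ expo nu * D j rho `^ (- delta)))%:E <=
   weight_cst%:E * lhs)%E.
Proof.
move=> nuM rho0 rhoL; have [w wP] := exists_square_poly_large M P (r j) rho sP rho0.
set h := rho / _ in wP; have h0 : 0 < h by rewrite divr_gt0 // mulr_gt0.
set CM := M`!%:R * (8 * M%:R + 9) ^+ M in wP.
have CM0 : 0 < CM.
  have c0 : 0 < 8 * M%:R + 9 :> R by rewrite ltr_wpDl ?mulr_ge0.
  by rewrite mulr_gt0 ?exprn_gt0 // ltr0n fact_gt0.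
have D0 : 0 < D j rho by exact: maxprod_gt0.
have two0 : 0 < (2 : R) ^+ N by rewrite exprn_gt0.
(* A square of area h^2 inside the disk of radius [h] about [w]; on it the integrand is at least the
   constant [v] below. *)
pose A := square w (h / 2).
have mA : measurable A by exact: measurable_square.
have AP p : A p -> cabs (cpt p - w) < h by exact: square_cabs_lt.
have AD : (A `<=` disk Lambda)%classic.
  move=> p /AP/wP[pr _]; rewrite /disk -[cpt p](subrK (r j)).
  apply: le_lt_trans (cabs_triangle _ _) _.
  by have := r_lt j; move: pr rhoL; lra.
pose x := cabs (P^`(nu)).[r j] * rho ^+ nu / CM.
have x0 : 0 <= x by rewrite divr_ge0 ?mulr_ge0 ?cabs_ge0 ?exprn_ge0 ?(ltW rho0) ?(ltW CM0).
pose v := x `^ eps / (2 ^+ N * D j rho) `^ delta.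
have v0 : 0 <= v by rewrite divr_ge0 ?powR_ge0.
have Av p : A p -> (v%:E <= integrand eps delta P Q p)%E.
  move=> /AP/wP[pr /(_ _ nuM) Pp]; rewrite /integrand.
  case: eqVneq => [_|q0]; first by rewrite leey.
  rewrite lee_fin; apply: ler_pM; rewrite ?powR_ge0 ?invr_ge0 ?powR_ge0 //.
    by rewrite ge0_ler_powR ?nnegrE ?cabs_ge0 // /x ler_pdivrMr // [leRHS]mulrC.
  have {}q0 : 0 < cabs Q.[cpt p] `^ delta by rewrite lt_neqAle eq_sym q0 powR_ge0.
  have D2 : 0 < (2 ^+ N * D j rho) `^ delta by rewrite powR_gt0 ?mulr_gt0.
  rewrite lef_pV2 ?posrE //.
  rewrite ge0_ler_powR ?nnegrE ?cabs_ge0 ?mulr_ge0 ?(ltW D0) ?(ltW two0) //.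
  by apply: cabs_prod_le_maxprod; exact: ltW.
have mf := measurable_integrand eps delta P Q.
have vh : ((v * h ^+ 2)%:E <= lhs)%E.
  apply: (@le_trans _ _ (\int[@dV R]_(p in A) integrand eps delta P Q p)%E); last first.
    apply: ge0_subset_integral.
    - exact: mA.
    - exact: measurable_disk.
    - exact: (measurable_funS measurableT (@subsetT _ _) mf).
    - by move=> p _; exact: integrand_ge0.
    - exact: AD.
  have <- : (\int[@dV R]_(p in A) (cst v%:E) p = (v * h ^+ 2)%:E)%E.
    have -> : (v * h ^+ 2)%:E = (v%:E * @dV R A)%E.
      by rewrite dV_square ?divr_gt0 // -EFinM; congr EFin; field.
    by rewrite /dV integral_cst.
  apply: ge0_le_integral.
  - exact: mA.
  - by move=> p _; rewrite lee_fin.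
  - exact: measurable_cst.
  - exact: (measurable_funS measurableT (@subsetT _ _) mf).
  - exact: Av.
apply: le_trans (lee_wpmul2l _ vh); last by rewrite lee_fin ltW // weight_cst_gt0.
rewrite -EFinM lee_fin le_eqVlt; apply/orP; left; apply/eqP.
have -> : weight_cst = CM `^ eps * 2 `^ (N%:R * delta) * (4 * M.+1%:R) ^+ 2 by [].
clearbody CM; rewrite /v /x /h !powRM ?invr_ge0 ?mulr_ge0 ?cabs_ge0 ?exprn_ge0
  ?(ltW rho0) ?(ltW CM0) ?(ltW D0) //.
rewrite powRV ?(ltW CM0) // !powRN !powR_exprn ?(ltW rho0) //.
rewrite gt0_powRD // (powR_mulrn 2 (ltW rho0)).
have c1 : CM `^ eps != 0 by rewrite gt_eqF ?powR_gt0.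
have c2 : 2 `^ (N%:R * delta) != 0 :> R by rewrite gt_eqF ?powR_gt0.
have c3 : D j rho `^ delta != 0 by rewrite gt_eqF ?powR_gt0.
have c4 : M.+1%:R != 0 :> R by rewrite pnatr_eq0.
move: c4 c3 c2 c1; move: (M.+1%:R) (D j rho `^ delta) (2 `^ _) (CM `^ _) => a b c d *.
by field; apply/and4P; split.
Qed.

(** The radius is [X / 2], which is at most [Lambda / 2]. Halving costs 2^(nu eps + 2), and [D] can
    only decrease. *)
Let term_le_of_scale j nu (X E : R) : (nu <= M)%N -> 0 < X -> X <= Lambda -> 0 < E ->
  D j X <= E -> Phi j nu = X `^ (- expo nu) * E `^ delta ->
  (rhs_term r eps delta Lambda P (r j) nu <=
   (2 `^ expo M * weight_cst)%:E * lhs)%E.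
Proof.
move=> nuM X0 XL E0 DE PhiE.
have Phi0 : 0 < Phi j nu by rewrite PhiE mulr_gt0 ?powR_gt0.
rewrite /rhs_term gt_eqF // [X in (_ <= X * _)%E]EFinM -muleA.
have X20 : 0 < X / 2 by rewrite divr_gt0.
have X2L : X / 2 <= Lambda / 2 by rewrite ler_pM2r.
apply: le_trans (lee_wpmul2l _ (weight_le_lhs j _ _ nuM X20 X2L)); last first.
  by rewrite lee_fin powR_ge0.
rewrite -EFinM lee_fin mulrCA ler_wpM2l ?powR_ge0 // PhiE invfM -!powRN opprK.
rewrite mulrA; apply: ler_pM; rewrite ?powR_ge0 //.
  rewrite powRM ?invr_ge0 ?(ltW X0) // powRV // mulrCA ler_peMr ?powR_ge0 //.
  rewrite -gt0_powRD // -[leLHS](powRr0 2); apply: ler_powR; first by rewrite ler1n.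
  have : nu%:R * eps <= M%:R * eps by rewrite ler_wpM2r // ler_nat.
  by lra.
rewrite ler_powRN ?maxprod_gt0 //; apply: le_trans DE.
by apply: maxprod_le; lra.
Qed.

(** If [Lk] vanishes, at least m = N - k roots coincide with [alpha], so D(rho) is at most a
    multiple of rho^m. As m delta > nu eps + 2, the lower bound from [weight_le_lhs] blows up as rho
    tends to 0. *)
Let lhs_infinite j nu (k : 'I_N) : (nu <= M)%N -> (P^`(nu)).[r j] != 0 ->
  @knu R N eps delta nu = Some k -> Lk r (r j) k = 0 -> lhs = +oo%E.
Proof.
move=> nuM P0 knuE L0; have [_ lt] := knu_Some _ _ _ _ _ knuE.
set m := (N - k)%N in lt; pose gam := m%:R * delta - expo nu.
have gam0 : 0 < gam by rewrite subr_gt0.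
pose b := cabs (P^`(nu)).[r j] `^ eps * ((Lambda ^+ N) `^ (- delta) * Lambda `^ (m%:R * delta)).
have b0 : 0 < b.
  rewrite !mulr_gt0 ?powR_gt0 ?exprn_gt0 //.
  by rewrite lt_neqAle cabs_ge0 andbT eq_sym cabs_eq0.
have blow rho : 0 < rho -> rho <= Lambda / 2 ->
    ((b * rho `^ (- gam))%:E <= weight_cst%:E * lhs)%E.
  move=> rho0 rhoL; apply: le_trans (weight_le_lhs j _ _ nuM rho0 rhoL).
  have rL : rho <= Lambda by move: rhoL Lambda0; lra.
  have card_le : (m <= #|[set i | (cabs (r j - r i) <= rho)%R]|)%N.
    apply: leq_trans (card_dist_le_Lk r j k (ltn_ord k)) _.
    apply: subset_leq_card; apply/fintype.subsetP => i; rewrite !inE L0 => /le_trans -> //.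
    exact: ltW.
  (* The growth is taken from [rho] up to [Lambda], where [D] is exactly [Lambda ^+ N]. *)
  have := maxprod_growth r (r j) _ _ _ rho0 rL card_le.
  rewrite (maxprod_large _ _ _ r_lt j Lambda) // => DL.
  have Lr0 : 0 < Lambda / rho by rewrite divr_gt0.
  have Dle : D j rho <= (rho / Lambda) ^+ m * Lambda ^+ N.
    by rewrite -[rho / _]invf_div exprVn -ler_pdivrMl ?invr_gt0 ?exprn_gt0 // invrK.
  rewrite lee_fin /b -mulrA ler_wpM2l ?powR_ge0 //.
  apply: le_trans (ler_wpM2l (powR_ge0 _ _) (ler_powRN _ _ _ delta0 (maxprod_gt0 _ _ _ rho0) Dle)).
  rewrite powRM ?exprn_ge0 ?divr_ge0 ?(ltW rho0) ?(ltW Lambda0) //.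
  rewrite (@powR_exprn _ (rho / Lambda)) ?divr_ge0 ?(ltW rho0) ?(ltW Lambda0) //.
  rewrite powRM ?invr_ge0 ?(ltW rho0) ?(ltW Lambda0) // powRV ?(ltW Lambda0) // mulrN opprK.
  rewrite /gam opprB gt0_powRD // le_eqVlt; apply/orP; left; apply/eqP; ring.
have := lhs_ge0; case lhsE : lhs => [x| |] // x0; exfalso.
(* Chosen so that [b * A] exceeds [weight_cst * x]; [rho] is then small enough for its power -gam to
   reach [A]. *)
pose A := (weight_cst * x + 1) / b.
have x0' : 0 <= x by rewrite -lee_fin.
have A0 : 0 < A by rewrite divr_gt0 // ltr_wpDl // mulr_ge0 // ltW // weight_cst_gt0.
pose rho := Num.min (Lambda / 2) (A `^ (- gam^-1)).
have rho0 : 0 < rho by rewrite lt_min divr_gt0 //= powR_gt0.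
have rhoL : rho <= Lambda / 2 by rewrite ge_min lexx.
have := blow rho rho0 rhoL; rewrite lhsE -EFinM lee_fin.
have : A <= rho `^ (- gam).
  have -> : A = (A `^ (- gam^-1)) `^ (- gam).
    by rewrite -powRrM mulrNN mulVf ?gt_eqF // powRr1 // ltW.
  by rewrite ler_powRN ?(ltW gam0) // ge_min lexx orbT.
move=> Arho bA; have := le_trans (ler_wpM2l (ltW b0) Arho) bA.
by rewrite /A mulrCA divff ?gt_eqF // mulr1; lra.
Qed.

Lemma rhs_term_le_lhs j nu : (nu <= M)%N -> (P^`(nu)).[r j] != 0 ->
  (rhs_term r eps delta Lambda P (r j) nu <=
   (2 `^ expo M * weight_cst)%:E * lhs)%E.
Proof.
move=> nuM P0; case knuE: (@knu R N eps delta nu) => [k|]; last first.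
  apply: (term_le_of_scale _ _ Lambda (Lambda ^+ N)) => //; first by rewrite exprn_gt0.
    by rewrite (maxprod_large _ _ _ r_lt).
  exact: Phi_NoneE.
have [L0|L0] := eqVneq (Lk r (r j) k) 0.
  rewrite (lhs_infinite _ _ _ nuM P0 knuE L0) gt0_muley ?leey //.
  by rewrite lte_fin mulr_gt0 ?powR_gt0 // weight_cst_gt0.
have {}L0 : 0 < Lk r (r j) k by rewrite lt_neqAle eq_sym L0 Lk_ge0.
have DE := maxprod_le_scaleprod r j k (ltn_ord k) L0.
apply: (term_le_of_scale _ _ (Lk r (r j) k) (scaleprod r j k)) => //.
- exact/ltW/Lk_lt_Lambda.
- by apply: lt_le_trans DE; exact: maxprod_gt0.
- exact: Phi_SomeE.
Qed.

End LowerBound.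

(** * Choice of the constant and conclusion *)

Theorem theorem1 (R : realType) (eps delta : R) (M N : nat) :
  0 <= eps -> 0 <= delta -> (0 < M)%N -> (0 < N)%N ->
  (forall k nu : nat, (k <= N)%N -> (nu <= M)%N ->
     nu%:R * eps + 2 - (N - k)%:R * delta != 0) ->
  exists C : R, 0 < C /\
    forall (Lambda : R) (P Q : {poly R[i]}) (r : 'I_N -> R[i]),
      0 < Lambda ->
      size P = M.+1 ->
      Q = \prod_(i < N) ('X - (r i)%:P) ->
      (forall i, cabs (r i) < Lambda / 2) ->
      (lhs eps delta Lambda P Q <= C%:E * rhs r eps delta Lambda M P)%E /\
      (rhs r eps delta Lambda M P <= C%:E * lhs eps delta Lambda P Q)%E.
Proof.
move=> eps0 delta0 _ N0 nonres.
have [kap [kap0 kap1 kap_gap]] := exists_resonance_gap eps delta M N nonres.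
pose C1 := N%:R * (80 / (1 - 2 `^ (- kap)) *
  (M.+1%:R `^ eps * 2 `^ (N%:R * delta) * peak_cst eps delta M N)).
pose C2 := N%:R * M.+1%:R * (2 `^ (M%:R * eps + 2) * weight_cst eps delta M N).
have C2_gt0 : 0 < C2 by rewrite !mulr_gt0 ?ltr0n ?powR_gt0 ?weight_cst_gt0.
exists (Num.max C1 C2); split; first by rewrite lt_max C2_gt0 orbT.
move=> Lambda P Q r Lambda0 sP -> r_lt; split.
  (* If some [Phi] in the sum vanishes, the right-hand side is [+oo] and the first inequality is
     trivial. *)
  have [[j [nu [nuM P0 Phi0]]]|noPhi] := pselect (exists j nu,
    [/\ (nu <= M)%N, (P^`(nu)).[r j] != 0 & Phi r eps delta Lambda (r j) nu = 0]).
    have -> : rhs r eps delta Lambda M P = +oo%E.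
      apply/eqP; rewrite eq_le leey /=.
      by have := rhs_term_le_rhs eps delta Lambda M N r P j nu nuM P0; rewrite /rhs_term Phi0 eqxx.
    by rewrite gt0_muley ?leey // lte_fin lt_max C2_gt0 orbT.
  apply: le_trans (lhs_le_rhs_finite _ _ _ _ eps0 delta0 N0 nonres _ kap0 kap1 kap_gap
    _ _ _ Lambda0 r_lt sP _) _.
    move=> j nu nuM P0; apply/eqP => Phi0; apply: noPhi; exists j, nu; split => //.
  by rewrite lee_wpmul2r ?rhs_ge0 // lee_fin le_max lexx.
have lhs0 : (0 <= lhs eps delta Lambda P (\prod_(i < N) ('X - (r i)%:P)))%E.
  exact: lhs_ge0.
apply: (@le_trans _ _ (C2%:E * lhs eps delta Lambda P (\prod_(i < N) ('X - (r i)%:P)))%E);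
  last by rewrite lee_wpmul2r // lee_fin le_max lexx orbT.
rewrite /C2 EFinM -muleA; apply: rhs_le_const.
  by rewrite mule_ge0 // lee_fin mulr_ge0 ?powR_ge0 // ltW // weight_cst_gt0.
by move=> j nu nuM P0; apply: rhs_term_le_lhs.
Qed.
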